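(* There exists an absolute constant $C>0$ such that the following holds. If $G$ is a regular graph on $n$ vertices that is an $(\varepsilon,\gamma)$ small-set expander and $\lambda_2(G)\ge 1-\delta$, then $G$ contains a set $S$ of vertices with $|S|\le n/2$ such that $\Phi(S)\le C\cdot\frac{\delta}{\gamma^3\varepsilon^3}$. Furthermore, such a set $S$ can be found efficiently (in polynomial time).
   Context: For a $d$-regular graph $G$, $\lambda_2(G)$ denotes the second largest eigenvalue of the normalized transition matrix $A_G=\frac1d A$, where $A$ is the adjacency matrix. For $S\subseteq V$ nonempty, the edge expansion $\Phi(S)$ is the fraction of edges incident to $S$ (counted as pairs $(v,u)$ with $v\in S$) whose other endpoint lies outside $S$. $G$ is an $(\varepsilon,\gamma)$ small-set expander if every $S\subseteq V$ with $|S|\le\varepsilon|V|$ satisfies $\Phi(S)\ge\gamma$. *)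

(* Defs.v *)
From HB Require Import structures.
From mathcomp Require Import all_boot all_order all_algebra.
From mathcomp Require Import polyrcf.
From mathcomp Require Import reals.

Set Implicit Arguments.
Unset Strict Implicit.
Unset Printing Implicit Defensive.

Import Order.TTheory GRing.Theory Num.Theory.

Record sgraph (n : nat) := SGraph {
  adj :> rel 'I_n;
  adj_sym : symmetric adj;
  adj_irr : irreflexive adj
}.

Definition regular (n d : nat) (G : sgraph n) : Prop :=
  forall v : 'I_n, #|[set u | G v u]| = d.

Section Expansion.
Local Open Scope ring_scope.
Variable R : realType.

Definition adjacency_mx (n : nat) (G : sgraph n) : 'M[R]_n :=
  \matrix_(i, j) (G i j)%:R.

Definition transition_mx (n d : nat) (G : sgraph n) : 'M[R]_n :=
  d%:R^-1 *: adjacency_mx G.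

(* All real eigenvalues in nonincreasing order, each one repeated as many times
   as the dimension of its eigenspace. For a real symmetric matrix of size n
   this sequence has length n. *)
Definition eigenvalues (n : nat) (A : 'M[R]_n) : seq R :=
  sort >=%R
    (flatten [seq nseq (\rank (eigenspace A x)) x | x <- rootsR (char_poly A)]).

Definition lambda2 (n d : nat) (G : sgraph n) : R :=
  (eigenvalues (transition_mx d G))`_1.

(* Pairs (v, u), so that an edge inside S is counted twice. *)
Definition incident (n : nat) (G : sgraph n) (S : {set 'I_n}) :
    {set 'I_n * 'I_n} :=
  [set p | (p.1 \in S) && G p.1 p.2].

Definition expansion (n : nat) (G : sgraph n) (S : {set 'I_n}) : R :=
  #|[set p in incident G S | p.2 \notin S]|%:R / #|incident G S|%:R.

Definition small_set_expander (n : nat) (eps gamma : R) (G : sgraph n) : Prop :=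
  forall S : {set 'I_n}, S != set0 -> #|S|%:R <= eps * n%:R ->
    gamma <= expansion G S.

End Expansion.

(* Polynomial time is measured on a random access machine with the logarithmic
   cost criterion, programmed with structured control flow. Its memory cells
   are indexed by, and contain, natural numbers; an instruction is charged the
   bit lengths of all the addresses and operands it handles. *)

Definition memory := nat -> nat.

Inductive expr : Type :=
| ENum of nat
| ERead of expr
| EAdd of expr & expr
| ESub of expr & expr
| EMul of expr & expr
| EDiv of expr & expr.

Inductive cmd : Type :=
| CSkip
| CWrite of expr & expr
| CSeq of cmd & cmd
| CIf of expr & cmd & cmd
| CWhile of expr & cmd.

Definition bitlen (n : nat) : nat := (trunc_log 2 n).+1.

Fixpoint eval (m : memory) (e : expr) : nat :=
  match e with
  | ENum k => k
  | ERead a => m (eval m a)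
  | EAdd a b => eval m a + eval m b
  | ESub a b => eval m a - eval m b
  | EMul a b => eval m a * eval m b
  | EDiv a b => eval m a %/ eval m b
  end.

Fixpoint cost (m : memory) (e : expr) : nat :=
  let binary a b :=
    cost m a + cost m b + bitlen (eval m a) + bitlen (eval m b) in
  match e with
  | ENum k => bitlen k
  | ERead a => cost m a + bitlen (eval m a) + bitlen (m (eval m a))
  | EAdd a b => binary a b
  | ESub a b => binary a b
  | EMul a b => binary a b
  | EDiv a b => binary a b
  end.

Definition update (m : memory) (a x : nat) : memory :=
  fun b => if b == a then x else m b.

(* exec c m t m': started in memory m, the program c halts in memory m' after
   total cost t. A test succeeds when its value is nonzero. *)
Inductive exec : cmd -> memory -> nat -> memory -> Prop :=
| ExecSkip m : exec CSkip m 1 m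
| ExecWrite a e m :
    exec (CWrite a e) m
      (cost m a + cost m e + bitlen (eval m a) + bitlen (eval m e))
      (update m (eval m a) (eval m e))
| ExecSeq c1 c2 m m1 m2 t1 t2 :
    exec c1 m t1 m1 -> exec c2 m1 t2 m2 -> exec (CSeq c1 c2) m (t1 + t2) m2
| ExecIfT e c1 c2 m m1 t :
    eval m e != 0 -> exec c1 m t m1 ->
    exec (CIf e c1 c2) m (cost m e + bitlen (eval m e) + t) m1
| ExecIfF e c1 c2 m m1 t :
    eval m e = 0 -> exec c2 m t m1 ->
    exec (CIf e c1 c2) m (cost m e + bitlen (eval m e) + t) m1
| ExecWhileT e c m m1 m2 t1 t2 :
    eval m e != 0 -> exec c m t1 m1 -> exec (CWhile e c) m1 t2 m2 ->
    exec (CWhile e c) m (cost m e + bitlen (eval m e) + t1 + t2) m2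
| ExecWhileF e c m :
    eval m e = 0 ->
    exec (CWhile e c) m (cost m e + bitlen (eval m e)) m.

(* Cell 0 contains n, cells 1, ..., n^2 contain the rows of the adjacency
   matrix one after the other, and all the other cells contain 0. *)
Definition encode_graph (n : nat) (G : sgraph n) : memory :=
  fun a => if a is b.+1 then
             \sum_(i < n) \sum_(j < n) ((b == i * n + j) && G i j)
           else n.

Definition decode_set (n : nat) (m : memory) : {set 'I_n} :=
  [set i : 'I_n | m i != 0].

(* One program and one polynomial bound serve all n; polynomials in n are the
   same bounds as polynomials in the input length, which is of order n^2. *)
Definition polynomial_time (F : forall n, sgraph n -> {set 'I_n}) : Prop :=
  exists (c : cmd) (k : nat), forall (n : nat) (G : sgraph n),
    exists (t : nat) (m : memory),
      [/\ exec c (encode_graph G) t m, t <= k * n.+1 ^ k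
        & decode_set n m = F n G].

(* Main.v *)
(* Let M = d I + A and start the walk M^t e_v from every vertex v. For t below
   n^6 some iterate has energy (sum of (u_i - u_j)^2 over ordered edges)
   within a constant of what the second eigenvalue permits: norms of iterates
   are log-convex and decay no faster than the eigenvalue, and a loss of order
   n^-5 in the rate is absorbed by the crude bound that a vector of mean 0 on
   a graph all of whose threshold cuts contain an edge has energy at least
   4 |u|^2 / n^3.

   For such an iterate u, cut off the [eps n] smallest and largest values; by
   small-set expansion the tails carry little of |u|^2, so the remaining range
   W satisfies |u|^2 = O(n W^2). Divide it into about 1/eps equal bands: one of
   them contains at most [eps n] vertices, and a weighted coarea argument inside
   this band, where small-set expansion controls the weight, produces a
   threshold cut of expansion O((1 - lambda2) / (gamma eps^3)). The program
   returns the best among all threshold cuts of all iterates. *)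
Require Import Defs.
From mathcomp Require Import all_boot all_order all_algebra.
From mathcomp Require Import reals.
From mathcomp Require Import boolp polyrcf ring lra zify.

Set Implicit Arguments.
Unset Strict Implicit.
Unset Printing Implicit Defensive.

Import Order.TTheory GRing.Theory Num.Theory.

(** * Programs and their running time *)

(** Cheeger's inequality alone gives a cut of order sqrt(delta). Linearity in delta comes from
    charging the variation inside one band to [y (1 - y)]: this function lives on a small set, so
    small-set expansion bounds its norm by the energy itself. That step costs one factor 1/gamma.
    The other two in the statement cover the case where 1 - lambda2 exceeds gamma^2 / 96: the tails
    are then out of control, but the claimed bound is at least 1 and every set satisfies it. An
    eigenvector has irrational entries, which no memory cell can hold. The walk started from the
    indicator of a vertex has natural entries and differs from its mean-zero version by a constant,
    so both have the same threshold cuts. The summand d I makes the operator positive semidefinite.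
    Slow decay of the norm then forces a large Rayleigh quotient, hence small energy; with A alone,
    an eigenvalue near -d could keep the norm large. *)

Fixpoint esize (e : expr) : nat :=
  match e with
  | ENum k => k.+1
  | ERead a => (esize a).+1
  | EAdd a b | ESub a b | EMul a b | EDiv a b => (esize a + esize b).+1
  end.

Lemma esize_gt0 e : 0 < esize e. Proof. by case: e. Qed.

Lemma bitlen_le x w : x < 2 ^ w -> 0 < w -> bitlen x <= w.
Proof.
case: w => // w hx _; rewrite /bitlen ltnS.
have [->|x0] := posnP x; first by rewrite trunc_log0.
have /andP[h _] := trunc_log_bounds (isT : 1 < 2) x0.
by have := leq_ltn_trans h hx; rewrite ltn_exp2l.
Qed.

(** Bit lengths add up under products, and [esize] is additive for this reason. A constant [k]
    weighs [k.+1] because [k < 2 ^ k.+1]. *)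
Lemma eval_lt (m : memory) L e : (forall a, m a < 2 ^ L) ->
  eval m e < 2 ^ (esize e * L.+1).
Proof.
move=> hm; have widen a b x : a <= b -> x < 2 ^ a -> x < 2 ^ b.
  by move=> ab /leq_trans; apply; rewrite leq_exp2l.
elim: e => [k|e _|a iha b ihb|a iha b ihb|a iha b ihb|a iha b ihb] /=.
- apply: (@widen k.+1); first by rewrite leq_pmulr.
  by apply: (ltn_trans (ltnSn k)); apply: ltn_expl.
- by apply: widen (hm _); rewrite mulSn; lia.
- apply: (@widen (esize a * L.+1 + esize b * L.+1).+1); first by lia.
  rewrite expnS mul2n -addnn expnD.
  have : 0 < 2 ^ (esize a * L.+1) by rewrite expn_gt0.
  have : 0 < 2 ^ (esize b * L.+1) by rewrite expn_gt0.
  by move: iha ihb; set x := 2 ^ _; set y := 2 ^ _; nia.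
- by apply: (@widen (esize a * L.+1)); [lia | apply: leq_ltn_trans (leq_subr _ _) iha].
- apply: (@widen (esize a * L.+1 + esize b * L.+1)); first by lia.
  by rewrite expnD ltn_mul.
- by apply: (@widen (esize a * L.+1)); [lia | apply: leq_ltn_trans (leq_div _ _) iha].
Qed.

Lemma bitlen_eval (m : memory) L e : (forall a, m a < 2 ^ L) ->
  bitlen (eval m e) <= esize e * L.+1.
Proof. by move=> hm; rewrite bitlen_le ?eval_lt // muln_gt0 esize_gt0. Qed.

Lemma cost_le (m : memory) L e : (forall a, m a < 2 ^ L) ->
  cost m e <= esize e ^ 2 * L.+1.
Proof.
move=> hm; have hb := bitlen_eval _ hm.
have binary a b : cost m a <= esize a ^ 2 * L.+1 -> cost m b <= esize b ^ 2 * L.+1 ->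
    cost m a + cost m b + bitlen (eval m a) + bitlen (eval m b) <=
    (esize a + esize b).+1 ^ 2 * L.+1.
  by have := hb a; have := hb b; rewrite !expnS !expn0; move: (esize a) (esize b); nia.
elim: e => [k|e ih|a iha b ihb|a iha b ihb|a iha b ihb|a iha b ihb] /=;
  try exact: binary.
- apply: (@leq_trans k.+1); last by rewrite expnS expn1; nia.
  by apply: bitlen_le => //; apply: (ltn_trans (ltnSn k)); apply: ltn_expl.
- have : bitlen (m (eval m e)) <= L.+1.
    by apply: bitlen_le => //; apply: (leq_trans (hm _)); rewrite leq_exp2l.
  by have := hb e; move: ih; rewrite !expnS !expn0; move: (esize e); nia.
Qed.

(* A state is a family of 16 unbounded arrays, indexed by 0, ..., 15; a scalar
   variable is the cell 0 of an array. The index 16 gives access to the cells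
   1, ..., n^2 of the memory. *)
Definition state := nat -> nat -> nat.

Definition setst (s : state) k i x : state :=
  fun k' i' => if (k' == k) && (i' == i) then x else s k' i'.

Lemma setst_setst s k i x y : setst (setst s k i x) k i y = setst s k i y.
Proof. by apply/funext => a; apply/funext => b; rewrite /setst; case: (_ && _). Qed.

Inductive hexpr : Type :=
| HNum of nat
| HSize
| HLow of hexpr
| HCell of nat & hexpr
| HAdd of hexpr & hexpr
| HSub of hexpr & hexpr
| HMul of hexpr & hexpr.

Inductive hcmd : Type :=
| HSet of nat & hexpr & hexpr
| HPut of hexpr & hexpr
| HSeq of hcmd & hcmd
| HIf of hexpr & hcmd
| HFor of nat & nat & hcmd.

Section Semantics.
Variable n : nat.

(** Beyond [n * n] the cells are dealt out to the arrays by residue modulo 16, so every array is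
    unbounded and the layout does not depend on how far the arrays are used. *)
Definition conc (s : state) : memory := fun a =>
  if a == 0 then n else if a <= n * n then s 16 a
  else s ((a - (n * n).+1) %% 16) ((a - (n * n).+1) %/ 16).

Fixpoint heval (s : state) (e : hexpr) : nat :=
  match e with
  | HNum k => k
  | HSize => n
  | HLow a => conc s (heval s a)
  | HCell k a => s k (heval s a)
  | HAdd a b => heval s a + heval s b
  | HSub a b => heval s a - heval s b
  | HMul a b => heval s a * heval s b
  end.

(* [HFor x p c] runs [c] with the variable [x] ranging over 0, ..., n^p - 1. *)
Fixpoint hrun (c : hcmd) (s : state) : state :=
  match c with
  | HSet k i e => setst s k (heval s i) (heval s e)
  | HPut i e => if 0 < heval s i <= n * n then setst s 16 (heval s i) (heval s e) else s
  | HSeq c1 c2 => hrun c2 (hrun c1 s)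
  | HIf e c => if heval s e != 0 then hrun c s else s
  | HFor x p c =>
    setst (iteri (n ^ p) (fun i s => hrun c (setst s x 0 i)) s) x 0 (n ^ p)
  end.

End Semantics.

Fixpoint mulfree (e : hexpr) : bool :=
  match e with
  | HNum _ | HSize | HLow _ | HCell _ _ => true
  | HAdd a b | HSub a b => mulfree a && mulfree b
  | HMul _ _ => false
  end.

Fixpoint wfe (e : hexpr) : bool :=
  match e with
  | HNum _ | HSize => true
  | HLow a => wfe a
  | HCell k a => (k < 16) && wfe a
  | HAdd a b | HSub a b | HMul a b => wfe a && wfe b
  end.

Fixpoint writes (x : nat) (c : hcmd) : bool :=
  match c with
  | HSet k _ _ => k == x
  | HPut _ _ => x == 16
  | HSeq c1 c2 => writes x c1 || writes x c2
  | HIf _ c => writes x c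
  | HFor y _ c => (y == x) || writes x c
  end.

(* Stored values are free of products, so that an assignment lengthens the
   numbers in memory by a constant number of bits. *)
Fixpoint wfc (c : hcmd) : bool :=
  match c with
  | HSet k i e => [&& k < 16, wfe i, wfe e & mulfree e]
  | HPut i e => [&& wfe i, wfe e & mulfree e]
  | HSeq c1 c2 => wfc c1 && wfc c2
  | HIf e c => wfe e && wfc c
  | HFor x _ c => [&& x < 16, ~~ writes x c & wfc c]
  end.

Definition ESize : expr := ERead (ENum 0).

Definition addr k (i : expr) : expr :=
  EAdd (EAdd (EMul ESize ESize) (ENum k.+1)) (EMul (ENum 16) i).

Fixpoint cexpr (e : hexpr) : expr :=
  match e with
  | HNum k => ENum k
  | HSize => ESize
  | HLow a => ERead (cexpr a)
  | HCell k a => ERead (addr k (cexpr a))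
  | HAdd a b => EAdd (cexpr a) (cexpr b)
  | HSub a b => ESub (cexpr a) (cexpr b)
  | HMul a b => EMul (cexpr a) (cexpr b)
  end.

Definition var x : expr := ERead (addr x (ENum 0)).
Definition incr x : cmd := CWrite (addr x (ENum 0)) (EAdd (var x) (ENum 1)).
(** A branch only asks whether a value is nonzero. Truncated subtraction therefore encodes the
    comparison of the counter with [n ^ p], and the product in [in_low] encodes the conjunction
    [0 < i <= n * n]. *)
Definition below x p : expr := ESub (iter p (EMul ESize) (ENum 1)) (var x).
Definition in_low (i : expr) : expr := EMul i (ESub (EAdd (EMul ESize ESize) (ENum 1)) i).

Fixpoint ccmd (c : hcmd) : cmd :=
  match c with
  | HSet k i e => CWrite (addr k (cexpr i)) (cexpr e)
  | HPut i e => CIf (in_low (cexpr i)) (CWrite (cexpr i) (cexpr e)) CSkip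
  | HSeq c1 c2 => CSeq (ccmd c1) (ccmd c2)
  | HIf e c => CIf (cexpr e) (ccmd c) CSkip
  | HFor x p c => CSeq (CWrite (addr x (ENum 0)) (ENum 0))
                    (CWhile (below x p) (CSeq (ccmd c) (incr x)))
  end.

Definition write_ticks (a e : expr) : nat := (esize a + esize e).+1 ^ 2.
Definition test_ticks (e : expr) : nat := (esize e).+1 ^ 2.
Definition loop_ticks x p : nat :=
  test_ticks (below x p) + write_ticks (addr x (ENum 0)) (EAdd (var x) (ENum 1)).

(** One count serves two bounds: the number of bits by which stored values may lengthen, and the
    cost in units of the final word length. The extra round of a loop pays for resetting the counter
    and for the last, failing test. *)
Fixpoint ticks (c : hcmd) (n : nat) : nat :=
  match c with
  | HSet k i e => write_ticks (addr k (cexpr i)) (cexpr e)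
  | HPut i e => test_ticks (in_low (cexpr i)) + write_ticks (cexpr i) (cexpr e)
  | HSeq c1 c2 => ticks c1 n + ticks c2 n
  | HIf e c => test_ticks (cexpr e) + ticks c n
  | HFor x p c => (n ^ p).+1 * (ticks c n + loop_ticks x p)
  end.

Lemma write_ticks_le a e e' : esize e <= esize e' -> write_ticks a e <= write_ticks a e'.
Proof. by move=> h; rewrite /write_ticks leq_sqr ltnS leq_add2l. Qed.

(** * Correctness and cost of compiled programs *)

Section Compilation.
Variable n : nat.
Implicit Types (s : state) (c : hcmd) (e : hexpr).

Definition bounded L s := n < 2 ^ L /\ forall k i, s k i < 2 ^ L.

Lemma bounded_le L L' s : L <= L' -> bounded L s -> bounded L' s.
Proof.
move=> LL [hn hs]; have h : 2 ^ L <= 2 ^ L' by rewrite leq_exp2l.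
by split=> [|k i]; apply: leq_trans h.
Qed.

Lemma bounded_setst L s k i x : bounded L s -> x < 2 ^ L -> bounded L (setst s k i x).
Proof. by move=> [hn hs] hx; split=> // k' i'; rewrite /setst; case: ifP. Qed.

Lemma conc_bounded L s : bounded L s -> forall a, conc n s a < 2 ^ L.
Proof. by move=> [hn hs] a; rewrite /conc; case: (a == 0); case: (a <= n * n). Qed.

Lemma conc_field s k i : k < 16 -> conc n s ((n * n) + k.+1 + 16 * i) = s k i.
Proof.
move=> k16; rewrite /conc.
have -> : (n * n + k.+1 + 16 * i == 0) = false by lia.
have -> : (n * n + k.+1 + 16 * i <= n * n) = false by lia.
have -> : n * n + k.+1 + 16 * i - (n * n).+1 = i * 16 + k by lia.
by rewrite modnMDl divnMDl // modn_small // divn_small // addn0.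
Qed.

Lemma conc_setst s k i x : k < 16 ->
  conc n (setst s k i x) = update (conc n s) (n * n + k.+1 + 16 * i) x.
Proof.
move=> k16; apply/funext => a; rewrite /update /conc /setst.
case: eqP => [->|a0]; first by case: eqP => //; lia.
case: leqP => [aN|Na].
  have -> : (16 == k) = false by lia.
  by rewrite /=; case: eqP => //; lia.
have aE : a = n * n + 1 + (a - (n * n).+1) by lia.
move: (a - (n * n).+1) aE => b ->.
have bE := divn_eq b 16; have rlt := ltn_pmod b (isT : 0 < 16).
move: (b %/ 16) (b %% 16) bE rlt => q r bE rlt.
rewrite [X in _ = if X then _ else _](_ : _ = (r == k) && (q == i)) //.
by apply/eqP/andP => [h|[/eqP h1 /eqP h2]]; [split; apply/eqP |]; lia.
Qed.

Lemma conc_setlow s a x : 0 < a <= n * n ->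
  conc n (setst s 16 a x) = update (conc n s) a x.
Proof.
move=> ha; apply/funext => b; rewrite /update /conc /setst.
case: eqP => [->|b0]; first by case: eqP => //; lia.
case: leqP => [bN|Nb] /=; first by [].
rewrite ltn_eqF ?ltn_pmod //=; case: eqP => //; lia.
Qed.

Lemma eval_addr s k i : eval (conc n s) (addr k i) = n * n + k.+1 + 16 * eval (conc n s) i.
Proof. by []. Qed.

Lemma eval_cexpr s e : wfe e -> eval (conc n s) (cexpr e) = heval n s e.
Proof.
elim: e => //= [a iha|k a iha|a iha b ihb|a iha b ihb|a iha b ihb].
- by move=> /iha ->.
- by move=> /andP[k16 /iha ->]; rewrite conc_field.
- by move=> /andP[/iha -> /ihb ->].
- by move=> /andP[/iha -> /ihb ->].
- by move=> /andP[/iha -> /ihb ->].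
Qed.

Lemma heval_mulfree L s e : bounded L s -> mulfree e ->
  heval n s e < 2 ^ (L + esize (cexpr e)).
Proof.
move=> hb; have leaf x a : x < 2 ^ L -> x < 2 ^ (L + a).
  by move=> h; apply: (leq_trans h); rewrite leq_exp2l // leq_addr.
elim: e => //= [k _|_|a _ _|k a _ _|a iha b ihb|a iha b ihb].
- rewrite addnC expnD; apply: (@leq_trans (2 ^ k.+1)); last by rewrite leq_pmulr // expn_gt0.
  by apply: (ltn_trans (ltnSn k)); apply: ltn_expl.
- by apply: leaf; case: hb.
- by apply: leaf; apply: conc_bounded.
- by apply: leaf; case: hb.
- move=> /andP[/iha ha /ihb hb']; rewrite addnS addnA expnS mul2n -addnn.
  apply: (@leq_ltn_trans (2 ^ (L + esize (cexpr a)) + heval n s b)).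
    by rewrite leq_add2r ltnW.
  rewrite -addnS; apply: leq_add; rewrite ?leq_exp2l ?leq_addr //.
  by apply: (leq_trans hb'); rewrite leq_exp2l // addnAC leq_addr.
- move=> /andP[/iha ha _]; apply: leq_ltn_trans (leq_subr _ _) (leq_trans ha _).
  by rewrite leq_exp2l // leq_add2l -addnS leq_addr.
Qed.

Lemma hrun_unwritten c s x i : ~~ writes x c -> hrun n c s x i = s x i.
Proof.
elim: c s => [k a e|a e|c1 ih1 c2 ih2|e c ih|y p c ih] s /=.
- by rewrite /setst eq_sym => /negPf ->.
- by case: ifP => // _ /negPf x16; rewrite /setst x16.
- by rewrite negb_or => /andP[h1 h2]; rewrite ih2 // ih1.
- by case: ifP => // _; apply: ih.
- rewrite negb_or eq_sym => /andP[/negPf yx h]; rewrite /setst yx /=.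
  by elim: (n ^ p) => //= m IH; rewrite ih // yx /= IH.
Qed.

Lemma write_cost L s (a e : expr) : bounded L s ->
  cost (conc n s) a + cost (conc n s) e + bitlen (eval (conc n s) a) +
    bitlen (eval (conc n s) e) <= write_ticks a e * L.+1.
Proof.
move=> /conc_bounded hb; have := cost_le a hb; have := cost_le e hb.
have := bitlen_eval a hb; have := bitlen_eval e hb.
rewrite /write_ticks !expnS !expn0; move: (esize a) (esize e); nia.
Qed.

Lemma test_cost L s (e : expr) : bounded L s ->
  (cost (conc n s) e + bitlen (eval (conc n s) e)).+1 <= test_ticks e * L.+1.
Proof.
move=> /conc_bounded hb; have := cost_le e hb; have := bitlen_eval e hb.
rewrite /test_ticks !expnS !expn0; move: (esize e); nia.
Qed.

Lemma eval_below s x p : x < 16 -> eval (conc n s) (below x p) = n ^ p - s x 0.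
Proof.
move=> x16; rewrite /below /var /= -{2}[0]/(16 * 0) conc_field //.
by congr (_ - _); elim: p => //= p ->; rewrite expnS.
Qed.

Lemma eval_in_low s i : wfe i ->
  (eval (conc n s) (in_low (cexpr i)) != 0) = (0 < heval n s i <= n * n).
Proof.
move=> wi; rewrite /in_low /= eval_cexpr //.
by rewrite muln_eq0 negb_or subn_eq0 -ltnNge addn1 ltnS lt0n.
Qed.

Lemma leq_mulS a b x y : a <= b -> x <= y -> a * x.+1 <= b * y.+1.
Proof. by move=> ab xy; rewrite leq_mul. Qed.

Section Loop.
Variables (c : hcmd) (x p : nat) (T : nat).
Hypotheses (x16 : x < 16) (xc : ~~ writes x c).
Hypothesis ihc : forall s L, bounded L s ->
  exists t, [/\ exec (ccmd c) (conc n s) t (conc n (hrun n c s)),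
    t <= T * (L + T).+1 & bounded (L + T) (hrun n c s)].

Let B := T + loop_ticks x p.

Lemma loop_ticks_gt0 : 0 < loop_ticks x p.
Proof. by rewrite /loop_ticks addn_gt0 /test_ticks expn_gt0. Qed.

(** Induction on the number [m] of remaining passes, [k] being the passes already made. Word lengths
    grow by [B] in each pass, but all costs are charged at one common final length [M], which keeps
    the total linear in [m]. *)
Lemma exec_loop s L M m k : bounded L s -> s x 0 = k -> m + k = n ^ p ->
    L + m * B <= M ->
  exists t, [/\
    exec (CWhile (below x p) (CSeq (ccmd c) (incr x))) (conc n s) t
      (conc n (setst (iteri m (fun i s => hrun n c (setst s x 0 (k + i))) s) x 0 (n ^ p))),
    t <= (m * B + test_ticks (below x p)) * M.+1 &
    bounded M (setst (iteri m (fun i s => hrun n c (setst s x 0 (k + i))) s) x 0 (n ^ p))].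
Proof.
have setxx s' y : s' x 0 = y -> setst s' x 0 y = s'.
  move=> <-; apply/funext => a; apply/funext => b; rewrite /setst.
  by case: ifP => // /andP[/eqP -> /eqP ->].
elim: m s L k => [|m IH] s L k hb sk mk LM.
  rewrite /= setxx; last by rewrite sk -mk.
  have hbM : bounded M s by apply: bounded_le hb; move: LM; lia.
  eexists; split; [by apply: ExecWhileF; rewrite eval_below // sk; lia | | by []].
  by have := test_cost (below x p) hbM; rewrite mul0n; lia.
have [t1 [e1 ht1 hb1]] := ihc hb.
pose s1 := hrun n c s; pose s2 := setst s1 x 0 k.+1.
have s1k : s1 x 0 = k by rewrite /s1 hrun_unwritten.
have k1 : k.+1 < 2 ^ (L + B).
  have : k < 2 ^ L by rewrite -sk; case: hb.
  have : 2 ^ L.+1 <= 2 ^ (L + B).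
    by rewrite leq_exp2l // /B; have := loop_ticks_gt0; lia.
  rewrite expnS; lia.
have hb2 : bounded (L + B) s2.
  by apply: bounded_setst => //; apply: bounded_le hb1; rewrite /B addnA leq_addr.
have LM2 : L + B + m * B <= M by move: LM; rewrite mulSn addnA.
have mk2 : m + k.+1 = n ^ p by rewrite -mk addnS.
have s2x : s2 x 0 = k.+1 by rewrite /s2 /setst !eqxx.
have [t2 [e2 ht2 hb3]] := IH s2 (L + B) k.+1 hb2 s2x mk2 LM2.
(* A pass starts by setting the counter, which hides the increment. For [m = 0] no pass follows and
   the two states differ in the counter; the final assignment then makes them agree. *)
have iterE : iteri m (fun i s => hrun n c (setst s x 0 (k.+1 + i))) s2 =
    iteri m.+1 (fun i s => hrun n c (setst s x 0 (k + i))) s \/ m = 0.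
  case: m {IH LM LM2 mk mk2 e2 ht2 hb3} => [|m]; [by right | left].
  elim: m => [|m IHm] /=.
    by rewrite !addn0 addn1 (setxx s k) // -/s1 /s2 setst_setst.
  by rewrite /= in IHm; rewrite IHm addSnnS.
have finE : setst (iteri m (fun i s => hrun n c (setst s x 0 (k.+1 + i))) s2) x 0 (n ^ p) =
    setst (iteri m.+1 (fun i s => hrun n c (setst s x 0 (k + i))) s) x 0 (n ^ p).
  case: iterE => [-> //|m0]; by rewrite m0 /= addn0 (setxx s) // /s2 !setst_setst.
rewrite finE in e2 hb3; exists (cost (conc n s) (below x p) +
  bitlen (eval (conc n s) (below x p)) + (t1 + (cost (conc n s1) (addr x (ENum 0)) +
  cost (conc n s1) (EAdd (var x) (ENum 1)) +
  bitlen (eval (conc n s1) (addr x (ENum 0))) +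
  bitlen (eval (conc n s1) (EAdd (var x) (ENum 1))))) + t2); split=> //.
  apply: ExecWhileT e2; first by rewrite eval_below // sk -lt0n; lia.
  apply: ExecSeq e1 _.
  have -> : conc n s2 = update (conc n s1) (eval (conc n s1) (addr x (ENum 0)))
      (eval (conc n s1) (EAdd (var x) (ENum 1))).
    rewrite /s2 conc_setst //; congr update.
    by rewrite /= -{2}[0]/(16 * 0) conc_field // s1k addn1.
  exact: ExecWrite.
have LB : L + B <= M by move: LM2; lia.
have h1 := test_cost (below x p) hb.
have h2 := write_cost (addr x (ENum 0)) (EAdd (var x) (ENum 1)) hb1.
have h3 : t1 <= T * M.+1.
  by apply: (leq_trans ht1); apply: leq_mulS => //; apply: leq_trans LB; rewrite /B; lia.
have h4 : test_ticks (below x p) * L.+1 <= test_ticks (below x p) * M.+1.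
  by apply: leq_mulS => //; apply: leq_trans LB; lia.
have h5 : write_ticks (addr x (ENum 0)) (EAdd (var x) (ENum 1)) * (L + T).+1 <=
    write_ticks (addr x (ENum 0)) (EAdd (var x) (ENum 1)) * M.+1.
  by apply: leq_mulS => //; apply: leq_trans LB; rewrite /B; lia.
have -> : (m.+1 * B + test_ticks (below x p)) * M.+1 = T * M.+1 + test_ticks (below x p) * M.+1 +
    write_ticks (addr x (ENum 0)) (EAdd (var x) (ENum 1)) * M.+1 +
    (m * B + test_ticks (below x p)) * M.+1.
  by rewrite mulSn {1}/B /loop_ticks !mulnDl !addnA.
have h6 := leq_trans (ltnW h1) h4; have h7 := leq_trans h2 h5.
by rewrite leq_add // [X in _ <= X + _]addnC -[leqRHS]addnA leq_add // leq_add.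
Qed.

End Loop.

(** The bound [T * (L + T).+1] is stable under sequencing: the second command starts at word length
    [L + T1], and charging both parts at length [L + T1 + T2] gives the same bound for [T1 + T2]. *)
Theorem ccmd_correct c s L : wfc c -> bounded L s ->
  exists t, [/\ exec (ccmd c) (conc n s) t (conc n (hrun n c s)),
    t <= ticks c n * (L + ticks c n).+1 & bounded (L + ticks c n) (hrun n c s)].
Proof.
elim: c s L => [k i e|i e|c1 ih1 c2 ih2|e c ih|x p c ih] s L /=.
- move=> /and4P[k16 wi we me] hb; have hw := write_cost (addr k (cexpr i)) (cexpr e) hb.
  eexists; split.
  + rewrite conc_setst // -(eval_cexpr s wi) -(eval_cexpr s we) -eval_addr; exact: ExecWrite.
  + apply: (leq_trans hw); apply: leq_mulS => //; exact: leq_addr.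
  + apply: bounded_setst; first by apply: bounded_le hb; apply: leq_addr.
    apply: (leq_trans (heval_mulfree hb me)); rewrite leq_exp2l // leq_add2l.
    rewrite /write_ticks expnS expn1; nia.
- move=> /and3P[wi we me] hb; have hw := write_cost (cexpr i) (cexpr e) hb.
  have ht := test_cost (in_low (cexpr i)) hb.
  set A := test_ticks _ in ht *; set W := write_ticks _ _ in hw *.
  have hT : A * L.+1 + W * L.+1 <= (A + W) * (L + (A + W)).+1.
    by rewrite -mulnDl; apply: leq_mulS => //; apply: leq_addr.
  have := eval_in_low s wi; case: ifP => hlow htest.
  + eexists; split.
    * apply: ExecIfT htest _; rewrite conc_setlow // -(eval_cexpr s wi) -(eval_cexpr s we).
      exact: ExecWrite.
    * by apply: leq_trans hT; lia.
    * apply: bounded_setst; first by apply: bounded_le hb; apply: leq_addr.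
      apply: (leq_trans (heval_mulfree hb me)); rewrite leq_exp2l // leq_add2l.
      rewrite /W /write_ticks expnS expn1; nia.
  + eexists; split.
    * by apply: ExecIfF (ExecSkip _); move/negbFE/eqP: htest.
    * by apply: leq_trans hT; lia.
    * by apply: bounded_le hb; apply: leq_addr.
- move=> /andP[w1 w2] hb.
  have [t1 [e1 ht1 hb1]] := ih1 s L w1 hb.
  have [t2 [e2 ht2 hb2]] := ih2 _ _ w2 hb1.
  exists (t1 + t2); split; [exact: ExecSeq e1 e2 | | by rewrite addnA].
  rewrite mulnDl addnA leq_add //; apply: (leq_trans ht1); apply: leq_mulS => //; exact: leq_addr.
- move=> /andP[we wc] hb; have ht := test_cost (cexpr e) hb.
  set A := test_ticks _ in ht *.
  have hT : A * L.+1 + ticks c n * (L + ticks c n).+1 <= (A + ticks c n) * (L + (A + ticks c n)).+1.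
    by rewrite mulnDl leq_add //; apply: leq_mulS => //; lia.
  rewrite -(eval_cexpr s we); case: ifP => he.
  + have [t [e1 ht1 hb1]] := ih s L wc hb.
    eexists; split; [exact: ExecIfT he e1 | by apply: leq_trans hT; lia |].
    by apply: bounded_le hb1; lia.
  + eexists; split; [by apply: ExecIfF (ExecSkip _); move/negbFE/eqP: he | |].
      by apply: leq_trans hT; lia.
    by apply: bounded_le hb; lia.
- move=> /and3P[x16 xc wc] hb.
  set B := ticks c n + loop_ticks x p.
  pose s0 := setst s x 0 0.
  have hb0 : bounded L s0 by apply: bounded_setst => //; rewrite expn_gt0.
  have LM : L + n ^ p * B <= L + (n ^ p).+1 * B by rewrite leq_add2l leq_mul2r leqnSn orbT.
  have s0x : s0 x 0 = 0 by rewrite /s0 /setst !eqxx.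
  have [t [et htt hbt]] := exec_loop x16 xc (fun s L => ih s L wc) hb0 s0x (addn0 (n ^ p)) LM.
  have finE : setst (iteri (n ^ p) (fun i s => hrun n c (setst s x 0 (0 + i))) s0) x 0 (n ^ p) =
      setst (iteri (n ^ p) (fun i s => hrun n c (setst s x 0 i)) s) x 0 (n ^ p).
    case: (n ^ p) => [|m]; first by rewrite /= /s0 setst_setst.
    congr setst; elim: m => [|m IHm] /=; last by rewrite /= in IHm; rewrite IHm.
    by rewrite /s0 setst_setst.
  rewrite finE in et hbt; have hw := write_cost (addr x (ENum 0)) (ENum 0) hb.
  eexists; split; [apply: ExecSeq et | | exact: hbt].
    rewrite /s0 conc_setst //; exact: ExecWrite.
  apply: (leq_trans (leq_add hw htt)); rewrite mulSn -/B.
  have BE : B = ticks c n + (test_ticks (below x p) +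
    write_ticks (addr x (ENum 0)) (EAdd (var x) (ENum 1))) by [].
  have hW : write_ticks (addr x (ENum 0)) (ENum 0) * L.+1 <=
      write_ticks (addr x (ENum 0)) (EAdd (var x) (ENum 1)) * (L + (B + n ^ p * B)).+1.
    by apply: leq_mul; [apply: write_ticks_le | rewrite ltnS leq_addr].
  apply: (leq_trans (leq_add hW (leqnn _))); rewrite -mulnDl leq_mul2r; apply/orP; right.
  move: BE; move: (write_ticks _ (EAdd _ _)) (test_ticks _) (ticks c n) (n ^ p * B).
  clearbody B; lia.
Qed.

End Compilation.

(** * Polynomial bounds on running times *)

Section PolynomialBounds.
Implicit Types f g : nat -> nat.

Definition polybounded f := exists k, forall n, f n <= k * n.+1 ^ k.

Lemma polybounded_const a : polybounded (fun=> a).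
Proof. by exists a => n; rewrite leq_pmulr // expn_gt0. Qed.

Lemma polybounded_id : polybounded id.
Proof. by exists 1 => n; rewrite mul1n expn1. Qed.

Lemma polybounded_add f g : polybounded f -> polybounded g ->
  polybounded (fun n => f n + g n).
Proof.
move=> [k hk] [l hl]; exists (k + l) => n; rewrite mulnDl leq_add //.
  by apply: (leq_trans (hk n)); rewrite leq_mul // leq_pexp2l // leq_addr.
by apply: (leq_trans (hl n)); rewrite leq_mul // leq_pexp2l // leq_addl.
Qed.

Lemma polybounded_mul f g : polybounded f -> polybounded g ->
  polybounded (fun n => f n * g n).
Proof.
move=> [k hk] [l hl]; exists (k * l + (k + l)) => n.
apply: (leq_trans (leq_mul (hk n) (hl n))); rewrite mulnACA -expnD.
by rewrite leq_mul ?leq_addr // leq_pexp2l // leq_addl.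
Qed.

Lemma polybounded_exp p : polybounded (fun n => n ^ p).
Proof.
elim: p => [|p IH]; first exact: polybounded_const.
have [k hk] := polybounded_mul polybounded_id IH.
by exists k => n; rewrite expnS.
Qed.

Lemma polybounded_ticks c : polybounded (ticks c).
Proof.
elim: c => [k i e|i e|c1 ih1 c2 ih2|e c ih|x p c ih] /=.
- exact: polybounded_const.
- exact: polybounded_const.
- exact: polybounded_add.
- by apply: polybounded_add ih; apply: polybounded_const.
- apply: polybounded_mul.
    have [k hk] := polybounded_add (polybounded_const 1) (polybounded_exp p).
    by exists k => n; rewrite -add1n.
  by apply: polybounded_add => //; apply: polybounded_const.
Qed.

End PolynomialBounds.

Definition init n (G : sgraph n) : state :=
  fun k i => if k == 16 then encode_graph G i else 0.

Lemma encode_graph_le n (G : sgraph n) a : encode_graph G a.+1 <= n * n.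
Proof.
rewrite /encode_graph -[n in n * _]card_ord -sum_nat_const leq_sum // => i _.
rewrite -[leqRHS]card_ord -sum1_card leq_sum // => j _; exact: leq_b1.
Qed.

Lemma encode_graph_out n (G : sgraph n) a : n * n < a -> encode_graph G a = 0.
Proof.
case: a => // a; rewrite ltnS => ha; rewrite /encode_graph big1 // => i _.
rewrite big1 // => j _; case: eqP => // aE; exfalso; move: ha.
have := ltn_ord i; have := ltn_ord j; rewrite aE; nia.
Qed.

Lemma conc_init n (G : sgraph n) : conc n (init G) = encode_graph G.
Proof.
apply/funext => a; rewrite /conc /init; case: eqP => [-> //|_].
case: leqP => // ha; rewrite (encode_graph_out _ ha) ltn_eqF //.
by rewrite ltn_mod.
Qed.

Lemma bounded_init n (G : sgraph n) : bounded n (n + n) (init G).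
Proof.
have nn : n < 2 ^ (n + n).
  by apply: (leq_trans (ltn_expl n (isT : 1 < 2))); rewrite leq_exp2l // leq_addr.
split=> // k i; rewrite /init; case: ifP => _; last by rewrite expn_gt0.
case: i => [//|i]; apply: (leq_ltn_trans (encode_graph_le G i)).
by rewrite expnD ltn_mul // ltn_expl.
Qed.

(** Cell 0 holds [n], which every address computation reads, so the answer for vertex 0 is kept in
    the array [out] and moved to cell 0 only at the very end. *)
Definition output n (G : sgraph n) c out : {set 'I_n} :=
  let s := hrun n c (init G) in decode_set n (update (conc n s) 0 (s out 0)).

Lemma polynomial_time_output c out : wfc c -> out < 16 ->
  polynomial_time (fun n G => output G c out).
Proof.
move=> wc out16; pose w := write_ticks (ENum 0) (var out).
have [k hk] : polybounded (fun n => (ticks c n + w) * (n + n + ticks c n + 1)).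
  have pT := polybounded_ticks c.
  apply: polybounded_mul; first by apply: polybounded_add pT (polybounded_const _).
  apply: polybounded_add (polybounded_const 1).
  by apply: polybounded_add pT; apply: polybounded_add polybounded_id polybounded_id.
exists (CSeq (ccmd c) (CWrite (ENum 0) (var out))), k => n G.
have [t [et ht hb]] := ccmd_correct wc (bounded_init G).
have hw := write_cost (ENum 0) (var out) hb.
rewrite conc_init in et; eexists; eexists; split; first exact: ExecSeq et (ExecWrite _ _ _).
  apply: leq_trans (hk n); rewrite mulnDl addn1; exact: leq_add ht hw.
by rewrite /output /= -{1}[0]/(16 * 0) conc_field.
Qed.

(** * Energy and threshold cuts *)

Local Open Scope ring_scope.

Definition cutsize n (G : sgraph n) (S : {set 'I_n}) : nat :=
  (\sum_i \sum_j [&& G i j, i \in S & j \notin S])%N.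

Section Energy.
Variables (R : realFieldType) (n : nat) (G : sgraph n).
Implicit Types (f g h q : 'I_n -> R) (S : {set 'I_n}).

Definition energy f : R := \sum_i \sum_j (G i j)%:R * (f i - f j) ^+ 2.
Definition variation f : R := \sum_i \sum_j (G i j)%:R * `|f i - f j|.
Definition norm2 f : R := \sum_i f i ^+ 2.

Lemma sum_edge_swap (F : 'I_n -> 'I_n -> R) :
  \sum_i \sum_j (G i j)%:R * F j i = \sum_i \sum_j (G i j)%:R * F i j.
Proof.
rewrite exchange_big; apply: eq_bigr => i _; apply: eq_bigr => j _.
by rewrite adj_sym.
Qed.

Lemma energy_ge0 f : 0 <= energy f.
Proof.
by apply: sumr_ge0 => i _; apply: sumr_ge0 => j _; rewrite mulr_ge0 ?sqr_ge0.
Qed.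

Lemma variation_ge0 f : 0 <= variation f.
Proof. by apply: sumr_ge0 => i _; apply: sumr_ge0 => j _; rewrite mulr_ge0. Qed.

Lemma energy_lipschitz f g :
  (forall i j, (f i - f j) ^+ 2 <= (g i - g j) ^+ 2) -> energy f <= energy g.
Proof.
move=> h; apply: ler_sum => i _; apply: ler_sum => j _; exact: ler_wpM2l.
Qed.

Lemma norm2_ge0 f : 0 <= norm2 f.
Proof. by apply: sumr_ge0 => i _; rewrite sqr_ge0. Qed.

Lemma variation_indicator S :
  variation (fun i => (i \in S)%:R) = (cutsize G S)%:R *+ 2.
Proof.
have -> : (cutsize G S)%:R =
    \sum_i \sum_j (G i j)%:R * ((i \in S) && (j \notin S))%:R :> R.
  rewrite /cutsize natr_sum; apply: eq_bigr => i _.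
  by rewrite natr_sum; apply: eq_bigr => j _; rewrite -natrM mulnb.
rewrite mulr2n -{2}(sum_edge_swap (fun i j => ((i \in S) && (j \notin S))%:R)).
rewrite -big_split; apply: eq_bigr => i _; rewrite -big_split.
apply: eq_bigr => j _ /=; rewrite -mulrDr; congr (_ * _).
case: (i \in S); case: (j \in S) => /=;
  by rewrite ?subrr ?subr0 ?sub0r ?normrN ?normr1 ?normr0 ?addr0 ?add0r.
Qed.

(** Induction on the size of the support [S] of [h]: subtract the least positive value [s] of [h] on
    [S]. The variation drops by exactly [s] times that of the indicator of [S], and the upper level
    sets of the remainder are those of [h] at levels shifted by [s]. The factor 2 reflects that
    [variation] runs over ordered edges. *)
Lemma coarea q h : (forall i, 0 <= h i) ->
    (forall x : R, 0 <= x -> [set i | x < h i] != set0 ->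
       \sum_(i | x < h i) q i <= (cutsize G [set i | x < h i])%:R) ->
  (\sum_i q i * h i) *+ 2 <= variation h.
Proof.
move=> h0 hc; have [m] := ubnP #|[set i | 0 < h i]|.
elim: m => // m IHm in h h0 hc *; rewrite ltnS => leSm.
have [S0|[i1]] := set_0Vmem [set i | 0 < h i].
  rewrite big1 ?mul0rn ?variation_ge0 // => i _.
  have : i \notin [set i | 0 < h i] by rewrite S0 inE.
  by rewrite inE -leNgt => hi; rewrite (le_anti (introT andP (conj hi (h0 i)))) mulr0.
rewrite inE => hi1; pose S := [set i | 0 < h i].
have [i0 hi0 mini0] := @arg_minP _ _ _ i1 (fun i => 0 < h i) h hi1.
pose s := h i0; pose h' i := h i - s * (i \in S)%:R.
have hE i : h i = h' i + s * (i \in S)%:R by rewrite /h' subrK.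
have h'0 i : 0 <= h' i.
  rewrite /h' inE; case: (ltP 0 (h i)) => hi; last by rewrite mulr0 subr0.
  by rewrite mulr1 subr_ge0 mini0.
have h'E (x : R) : 0 <= x -> [set i | x < h' i] = [set i | x + s < h i].
  move=> x0; apply/setP=> i; rewrite !inE /h' inE; case: (ltP 0 (h i)) => hi.
    by rewrite mulr1 ltrBrDr.
  rewrite mulr0 subr0 [RHS]ltNge (le_trans hi) ?addr_ge0 //=; last exact: ltW.
  by rewrite ltNge (le_trans hi).
have varE : variation h = variation h' + s * ((cutsize G S)%:R *+ 2).
  rewrite -variation_indicator /variation mulr_sumr -big_split.
  apply: eq_bigr => i _; rewrite mulr_sumr -big_split; apply: eq_bigr => j _ /=.
  rewrite mulrCA -mulrDr; congr (_ * _); rewrite (hE i) (hE j).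
  have s0 : 0 <= s by apply: ltW.
  have out k : k \notin S -> h' k = 0.
    rewrite inE -leNgt => hk; rewrite /h' inE ltNge hk mulr0 subr0.
    by apply: le_anti; rewrite hk h0.
  have [iS|iS] := boolP (i \in S); have [jS|jS] := boolP (j \in S) => /=.
  - by rewrite subrr normr0 mulr0 addr0; congr `| _ |; ring.
  - rewrite (out j) // !(mulr0, mulr1, addr0, subr0, normr1).
    by rewrite !ger0_norm // addr_ge0.
  - rewrite (out i) // !(mulr0, mulr1, addr0, sub0r, normrN, normr1).
    by rewrite !ger0_norm // addr_ge0.
  - by rewrite !out // !(mulr0, subr0, normr0, addr0).
have sumE : \sum_i q i * h i = \sum_i q i * h' i + s * \sum_(i in S) q i.
  rewrite mulr_sumr [X in _ + X]big_mkcond -big_split; apply: eq_bigr => i _ /=.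
  by rewrite (hE i) mulrDr; case: (i \in S); rewrite ?mulr0 // mulr1 [s * _]mulrC.
have IH : (\sum_i q i * h' i) *+ 2 <= variation h'.
  have ltS : (#|[set i | (0 < h' i)%R]| < m)%N.
    rewrite h'E // (leq_trans _ leSm) //; apply: proper_card.
    apply/properP; split; first by apply/subsetP=> i; rewrite !inE add0r; apply: lt_trans.
    by exists i0; rewrite !inE ?add0r ?ltxx.
  apply: (IHm h') ltS => // x x0.
  have xs : 0 <= x + s by rewrite addr_ge0 // ltW.
  move: (hc _ xs); rewrite h'E // => hcx /hcx; apply: le_trans.
  rewrite le_eqVlt; apply/orP; left; apply/eqP; apply: eq_bigl => i.
  by move/setP/(_ i): (h'E x x0); rewrite !inE.
rewrite varE sumE mulrnDl lerD // -mulrnAr ler_wpM2l ?(ltW hi0) //.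
rewrite lerMn2r /=; have := hc 0 (lexx 0).
have -> : \sum_(i in S) q i = \sum_(i | 0 < h i) q i.
  by apply: eq_bigl => i; rewrite inE.
by apply; apply/set0Pn; exists i0; rewrite inE.
Qed.

End Energy.

Section RegularEnergy.
Variables (R : realFieldType) (n d : nat) (G : sgraph n).
Hypothesis regG : regular d G.
Implicit Types (f u y : 'I_n -> R) (S A : {set 'I_n}).

Lemma sum_edgel f : \sum_i \sum_j (G i j)%:R * f i = d%:R * \sum_i f i.
Proof.
rewrite mulr_sumr; apply: eq_bigr => i _; rewrite -mulr_suml; congr (_ * _).
rewrite -natr_sum -(regG i) cardsE -sum1_card [in RHS]big_mkcond.
by congr (_ %:R).
Qed.

Lemma sum_edger f : \sum_i \sum_j (G i j)%:R * f j = d%:R * \sum_i f i.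
Proof. by rewrite (sum_edge_swap G (fun i j => f i)) sum_edgel. Qed.

(** Cheeger's argument for functions supported in [A]: the coarea inequality for [f ^ 2] with
    constant weight, then AM-GM on [|f i - f j| * |f i + f j|], weighted by [gamma] so that half of
    the left side absorbs the second term. *)
Lemma energy_expanding (gamma : R) A f : 0 < gamma ->
    (forall S, S != set0 -> S \subset A ->
       gamma * d%:R * #|S|%:R <= (cutsize G S)%:R) ->
    (forall i, i \notin A -> f i = 0) ->
  gamma ^+ 2 * d%:R * norm2 f <= energy G f.
Proof.
move=> g0 hA fA.
have : (\sum_i (gamma * d%:R) * f i ^+ 2) *+ 2 <= variation G (fun i => f i ^+ 2).
  apply: coarea => [i|x x0 hne]; first exact: sqr_ge0.
  rewrite sumr_const -[leLHS]mulr_natr.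
  have -> : #|[pred i | x < f i ^+ 2]| = #|[set i | x < f i ^+ 2]|.
    by rewrite cardsE.
  apply: hA => //; apply/subsetP=> i; rewrite inE; apply: contraTT => /fA ->.
  by rewrite expr0n -leNgt.
have hv : gamma * variation G (fun i => f i ^+ 2) <=
    energy G f + gamma ^+ 2 * d%:R * norm2 f.
  have -> : gamma ^+ 2 * d%:R * norm2 f =
      \sum_i \sum_j (G i j)%:R * (gamma ^+ 2 / 2 * (f i ^+ 2 + f j ^+ 2)).
    transitivity (\sum_i \sum_j ((G i j)%:R * (gamma ^+ 2 / 2 * f i ^+ 2) +
                                 (G i j)%:R * (gamma ^+ 2 / 2 * f j ^+ 2))).
      under eq_bigr do rewrite big_split; rewrite big_split /=.
      rewrite (sum_edgel (fun i => gamma ^+ 2 / 2 * f i ^+ 2)).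
      rewrite (sum_edger (fun i => gamma ^+ 2 / 2 * f i ^+ 2)) -mulr_sumr /norm2.
      by set s := (\sum_i f i ^+ 2); field.
    by apply: eq_bigr => i _; apply: eq_bigr => j _; rewrite -mulrDr -mulrDr.
  rewrite /variation /energy mulr_sumr -big_split; apply: ler_sum => i _.
  rewrite mulr_sumr -big_split; apply: ler_sum => j _ /=.
  rewrite mulrCA -mulrDr ler_wpM2l //.
  rewrite subr_sqr normrM; set a := f i; set b := f j.
  rewrite -(real_normK (num_real (a - b))).
  have : (`|a + b|) ^+ 2 <= 2 * (a ^+ 2 + b ^+ 2).
    by rewrite real_normK ?num_real //; have := sqr_ge0 (a - b); lra.
  move: (`|a - b|) (`|a + b|) => p q hq.
  have := sqr_ge0 (p - gamma / 2 * q).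
  have : gamma ^+ 2 * q ^+ 2 <= gamma ^+ 2 * (2 * (a ^+ 2 + b ^+ 2)).
    by rewrite ler_wpM2l ?sqr_ge0.
  lra.
rewrite -mulr_sumr -/(norm2 f) => /(ler_wpM2l (ltW g0)) h1.
by have := le_trans h1 hv; lra.
Qed.

(* The weight [3 y ^+ 2 - 2 y ^+ 3] is the primitive of [6 y (1 - y)], which
   vanishes outside [0 < y < 1]: variation is only paid for where small-set
   expansion makes [y (1 - y)] small. *)
Lemma energy_unit_band (gamma c : R) y v :
    0 < gamma -> gamma <= 1 ->
    (forall i, 0 <= y i <= 1) -> y v = 1 ->
    (forall S, S != set0 -> S \subset [set i | 0 < y i < 1] ->
       gamma * d%:R * #|S|%:R <= (cutsize G S)%:R) ->
    (forall S, (forall i, y i = 1 -> i \in S) -> (forall i, y i = 0 -> i \notin S) ->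
       (forall i j, i \in S -> j \notin S -> y j < y i) -> c <= (cutsize G S)%:R) ->
  2 * c * gamma <= 9 * energy G y.
Proof.
move=> g0 g1 y01 yv sse hc.
pose D i := y i * (1 - y i).
pose H (x : R) := 3 * x ^+ 2 - 2 * x ^+ 3.
have HB a b : H a - H b = (a - b) * (3 * (a * (1 - a)) + 3 * (b * (1 - b)) + (a - b) ^+ 2).
  by rewrite /H; ring.
have D0 i : 0 <= D i by rewrite /D; have /andP[? ?] := y01 i; rewrite mulr_ge0 // subr_ge0.
have Hmono i j : y i <= y j -> H (y i) <= H (y j).
  move=> hij; rewrite -subr_ge0 HB mulr_ge0 ?subr_ge0 //.
  by have := D0 i; have := D0 j; have := sqr_ge0 (y j - y i); rewrite /D; lra.
have H0 i : 0 <= H (y i).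
  have -> : H (y i) = 3 * y i * D i + y i ^+ 3 by rewrite /H /D; ring.
  by have /andP[? ?] := y01 i; rewrite addr_ge0 ?exprn_ge0 // mulr_ge0 // mulr_ge0.
(* The whole weight [c] sits at [v]. Since [y v = 1] is maximal and [H] is monotone on the values of
   [y], every nonempty upper level set contains [v], so the coarea hypothesis is just the cut bound
   [c]. *)
have coar : (\sum_i (c * (i == v)%:R) * H (y i)) *+ 2 <= variation G (fun i => H (y i)).
  apply: coarea => // x x0 /set0Pn[k]; rewrite inE => hk.
  have hv : x < H (y v).
    by apply: (lt_le_trans hk); apply: Hmono; rewrite yv; case/andP: (y01 k).
  rewrite (bigD1 v) //= eqxx mulr1 big1 ?addr0; last first.
    by move=> i /andP[_ /negPf ->]; rewrite mulr0.
  apply: hc => [i yi|i yi|i j].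
  - by rewrite inE yi -yv.
  - by rewrite inE yi -leNgt /H !expr0n /= !mulr0 subr0.
  - rewrite !inE -leNgt => hi hj; rewrite ltNge; apply/negP => /Hmono hij.
    by have := lt_le_trans hi (le_trans hij hj); rewrite ltxx.
have sumE : \sum_i (c * (i == v)%:R) * H (y i) = c.
  rewrite (bigD1 v) //= eqxx mulr1 big1 ?addr0 => [|i /negPf ->]; last by rewrite mulr0 mul0r.
  by rewrite yv /H !expr1n; ring.
(* [D] vanishes outside the band, where all subsets expand, and [x (1 - x)] is 1-Lipschitz on the
   unit interval, so its energy is at most that of [y]. *)
have hD : gamma ^+ 2 * d%:R * norm2 D <= energy G y.
  apply: (@le_trans _ _ (energy G D)).
    apply: (energy_expanding g0 sse) => i; rewrite inE negb_and -!leNgt => hi.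
    rewrite /D; have /andP[ha hb] := y01 i; case/orP: hi => hi.
      by rewrite (_ : y i = 0) ?mul0r //; apply: le_anti; rewrite hi ha.
    by rewrite (_ : y i = 1) ?subrr ?mulr0 //; apply: le_anti; rewrite hi hb.
  apply: ler_sum => i _; apply: ler_sum => j _; apply: ler_wpM2l => //.
  have -> : D i - D j = (y i - y j) * (1 - y i - y j) by rewrite /D; ring.
  rewrite exprMn -[leRHS]mulr1 ler_wpM2l ?sqr_ge0 //.
  have /andP[? ?] := y01 i; have /andP[? ?] := y01 j.
  by rewrite -real_normK ?num_real // expr_le1 // ler_norml; lra.
(* AM-GM handles the products of [|y i - y j|] with [D], and the cubic term is at most the square
   because [gamma] and [|y i - y j|] are at most 1. With [hD] the right side is at most
   [9 * energy G y]. *)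
have hvar : gamma * variation G (fun i => H (y i)) <=
    3 * energy G y + 6 * (gamma ^+ 2 * d%:R * norm2 D).
  have -> : 6 * (gamma ^+ 2 * d%:R * norm2 D) =
      \sum_i \sum_j (G i j)%:R * (3 * gamma ^+ 2 * (D i ^+ 2 + D j ^+ 2)).
    transitivity (\sum_i \sum_j ((G i j)%:R * (3 * gamma ^+ 2 * D i ^+ 2) +
                                 (G i j)%:R * (3 * gamma ^+ 2 * D j ^+ 2))).
      under eq_bigr do rewrite big_split; rewrite big_split /=.
      rewrite (sum_edgel (fun i => 3 * gamma ^+ 2 * D i ^+ 2)).
      rewrite (sum_edger (fun i => 3 * gamma ^+ 2 * D i ^+ 2)) -mulr_sumr /norm2.
      by set s := (\sum_i D i ^+ 2); ring.
    by apply: eq_bigr => i _; apply: eq_bigr => j _; rewrite -mulrDr -mulrDr.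
  rewrite /variation /energy !mulr_sumr -big_split; apply: ler_sum => i _.
  rewrite !mulr_sumr -big_split; apply: ler_sum => j _ /=.
  rewrite mulrCA [3 * _]mulrCA -mulrDr ler_wpM2l //.
  rewrite HB -/(D i) -/(D j) normrM.
  have := D0 i; have := D0 j; have := sqr_ge0 (y i - y j).
  move: (D i) (D j) => p q h0 hq hp.
  rewrite [`|3 * _ + _ + _|]ger0_norm; last by lra.
  have hx : `|y i - y j| <= 1.
    by have /andP[? ?] := y01 i; have /andP[? ?] := y01 j; rewrite ler_norml; lra.
  rewrite -(real_normK (num_real (y i - y j))).
  have := normr_ge0 (y i - y j); move: (`|y i - y j|) hx => x x1 x0.
  have h1 : gamma * (x * x ^+ 2) <= x ^+ 2.
    rewrite mulrA -[leRHS]mul1r ler_wpM2r ?sqr_ge0 //.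
    by rewrite -[leRHS]mulr1 ler_pM // ltW.
  have h2 := sqr_ge0 (x - gamma * (p + q)).
  have h3 : gamma ^+ 2 * (p + q) ^+ 2 <= gamma ^+ 2 * (2 * (p ^+ 2 + q ^+ 2)).
    by rewrite ler_wpM2l ?sqr_ge0 //; have := sqr_ge0 (p - q); lra.
  have h4 := sqr_ge0 x.
  rewrite !exprS !expr0 !mulr1 in h1 h2 h3 h4 *; lra.
move: coar; rewrite sumE => /(ler_wpM2l (ltW g0)) h1.
have := le_trans h1 hvar; lra.
Qed.

End RegularEnergy.

(** Take the least value whose sublevel set has at least [x] elements. If more than [x] elements lay
    strictly below it, the largest value among them would already qualify. *)
Lemma quantile (R : realFieldType) (n : nat) (u : 'I_n -> R) (x : R) :
    (0 < n)%N -> 0 <= x <= n%:R ->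
  exists v, #|[set i | u i < u v]|%:R <= x /\ x <= #|[set i | u i <= u v]|%:R.
Proof.
move=> n0 /andP[x0 xn].
have [vmax _ hmax] := @arg_maxP _ _ _ (Ordinal n0) predT u isT.
pose P v := x <= #|[set i | u i <= u v]|%:R.
have Pmax : P vmax.
  apply: (le_trans xn); rewrite ler_nat -[leqLHS]card_ord -cardsT.
  by apply: subset_leq_card; apply/subsetP=> i _; rewrite inE; apply: hmax.
have [v Pv hmin] := @arg_minP _ _ _ vmax P u Pmax.
exists v; split=> //; rewrite leNgt; apply/negP => hx.
have /set0Pn[k hk] : [set i | u i < u v] != set0.
  by apply/negP => /eqP h; move: hx; rewrite h cards0 ltNge x0.
have hk' : u k < u v by rewrite inE in hk.
have [v' hv' hmax'] := @arg_maxP _ _ _ k (fun i => u i < u v) u hk'.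
have Pv' : P v'.
  apply: (le_trans (ltW hx)); rewrite ler_nat; apply: subset_leq_card.
  by apply/subsetP=> i; rewrite !inE; apply: hmax'.
by have := lt_le_trans hv' (hmin _ Pv'); rewrite ltxx.
Qed.

Lemma pigeonhole_sparse (I : finType) (K : nat) (A : 'I_K -> {set I}) :
    (0 < K)%N -> (forall i j x, x \in A i -> x \in A j -> i = j) ->
  exists j, (#|A j| * K <= #|I|)%N.
Proof.
move=> K0 disj.
have [j _ jmin] := @arg_minnP _ (Ordinal K0) predT (fun j => #|A j|) isT.
exists j; have : (\sum_(i < K) #|A j| <= \sum_(i < K) #|A i|)%N.
  by apply: leq_sum => i _; apply: jmin.
rewrite sum_nat_const card_ord mulnC => /leq_trans; apply.
rewrite (eq_bigr (fun i => \sum_(x : I) (x \in A i))%N); last first.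
  by move=> i _; rewrite -sum1_card big_mkcond; apply: eq_bigr => x _; case: (x \in A i).
rewrite exchange_big /= -sum1_card; apply: leq_sum => x _.
have [/existsP[i xi]|h] := boolP [exists i, x \in A i].
  rewrite (bigD1 i) //= xi big1 // => k /eqP ki.
  by case: (boolP (x \in A k)) => // xk; case: ki; apply: disj xk xi.
by rewrite big1 // => i _; case: (boolP (x \in A i)) => // xi; case/existsP: h; exists i.
Qed.

Section Clip.
Variable R : realFieldType.
Implicit Types a b x : R.

Definition clip x : R := Num.max 0 (Num.min 1 x).

Lemma clip_itv x : 0 <= clip x <= 1.
Proof. by rewrite /clip /Num.max /Num.min; do 2 case: ifP; lra. Qed.

Lemma clip_eq0 x : x <= 0 -> clip x = 0.
Proof. by rewrite /clip /Num.max /Num.min; do 2 case: ifP; lra. Qed.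

Lemma clip_eq1 x : 1 <= x -> clip x = 1.
Proof. by rewrite /clip /Num.max /Num.min; do 2 case: ifP; lra. Qed.

Lemma clip_itvoo x : 0 < clip x < 1 -> 0 < x < 1.
Proof. by rewrite /clip /Num.max /Num.min; do 2 case: ifP; lra. Qed.

Lemma clip_le a b : a <= b -> clip a <= clip b.
Proof. by rewrite /clip /Num.max /Num.min; do 4 case: ifP; lra. Qed.

Lemma ler_sqr_dist a b x y : `|a - b| <= `|x - y| -> (a - b) ^+ 2 <= (x - y) ^+ 2.
Proof.
move=> h; rewrite -(real_normK (num_real (a - b))) -(real_normK (num_real (x - y))).
by rewrite lerXn2r ?nnegrE.
Qed.

Lemma clip_lipschitz a b : (clip a - clip b) ^+ 2 <= (a - b) ^+ 2.
Proof.
apply: ler_sqr_dist; wlog hab : a b / b <= a => [hw|].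
  have [/hw //|/ltW /hw] := leP b a; by rewrite distrC (distrC b).
rewrite !ger0_norm ?subr_ge0 ?clip_le // /clip /Num.max /Num.min.
by do 4 case: ifP; lra.
Qed.

Lemma max0_lipschitz a b : (Num.max 0 a - Num.max 0 b) ^+ 2 <= (a - b) ^+ 2.
Proof.
apply: ler_sqr_dist; wlog hab : a b / b <= a => [hw|].
  have [/hw //|/ltW /hw] := leP b a; by rewrite distrC (distrC b).
rewrite !ger0_norm ?subr_ge0 // /Num.max; by do 2 case: ifP; lra.
Qed.

End Clip.

Section ThresholdCuts.
Variables (R : realType) (n d : nat) (G : sgraph n).
Hypothesis regG : regular d G.

(** Here [lam] stands for 1 - lambda2 and [beta] for the least expansion of a threshold cut, up to
    the factor [d]. The cut hypothesis allows any real [m] below both sides, so it applies at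
    [m = eps * n] without asking which side is smaller. *)
Lemma threshold_cut_bound (u : 'I_n -> R) (eps gamma lam beta : R) :
    (0 < n)%N -> (0 < d)%N -> 0 < eps -> eps <= 1 -> 0 < gamma -> gamma <= 1 ->
    (forall S : {set 'I_n}, S != set0 -> #|S|%:R <= eps * n%:R ->
       gamma * d%:R * #|S|%:R <= (cutsize G S)%:R) ->
    \sum_i u i = 0 -> 0 < norm2 u -> energy G u <= 8 * d%:R * lam * norm2 u ->
    (forall (S : {set 'I_n}) (m : R), (forall i j, i \in S -> j \notin S -> u j < u i) ->
       m <= #|S|%:R -> m <= #|~: S|%:R -> beta * m <= (cutsize G S)%:R) ->
    lam <= gamma ^+ 2 / 96 ->
  beta <= 864 * d%:R * lam / (gamma * eps ^+ 3).
Proof.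
move=> n0 d0 e0 e1 g0 g1 sse u0 Npos hE hcut hlam.
set N := norm2 u in Npos hE.
have dpos : 0 < d%:R :> R by rewrite ltr0n.
have npos : 0 < n%:R :> R by rewrite ltr0n.
have en : 0 <= eps * n%:R <= n%:R.
  by rewrite mulr_ge0 ?(ltW e0) // -[leRHS]mul1r ler_wpM2r.
(* Both halves of the quantile are needed: strictly beyond it lie at most [eps * n] vertices, so the
   tails expand; up to and including it lie at least [eps * n], so cuts between [lo] and [hi] have
   two large sides. *)
have [vlo [lo1 lo2]] := quantile u n0 en.
have [vhi [hi1 hi2]] := quantile (fun i => - u i) n0 en.
set lo := u vlo in lo1 lo2; pose hi := u vhi.
have {}hi1 : #|[set i | hi < u i]|%:R <= eps * n%:R.
  by apply: le_trans hi1; rewrite ler_nat subset_leq_card //; apply/subsetP=> i;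
     rewrite !inE ltrN2.
have {}hi2 : eps * n%:R <= #|[set i | hi <= u i]|%:R.
  by apply: (le_trans hi2); rewrite ler_nat subset_leq_card //; apply/subsetP=> i;
     rewrite !inE lerN2.
have sseA (A : {set 'I_n}) : #|A|%:R <= eps * n%:R -> forall S : {set 'I_n}, S != set0 ->
    S \subset A -> gamma * d%:R * #|S|%:R <= (cutsize G S)%:R.
  move=> hA S hS SA; apply: sse => //; apply: le_trans hA.
  by rewrite ler_nat subset_leq_card.
pose p i : R := Num.max 0 (u i - hi); pose q i : R := Num.max 0 (lo - u i).
have tail (f : 'I_n -> R) (A : {set 'I_n}) : #|A|%:R <= eps * n%:R ->
    (forall i, i \notin A -> f i = 0) ->
    (forall i j, (f i - f j) ^+ 2 <= (u i - u j) ^+ 2) ->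
    gamma ^+ 2 * norm2 f <= 8 * lam * N.
  move=> hA fA /(energy_lipschitz G) hf.
  have := energy_expanding regG g0 (sseA A hA) fA.
  move=> /le_trans/(_ hf)/le_trans/(_ hE) h.
  by rewrite -(ler_pM2l dpos); move: h; move: (norm2 f) => z; lra.
have hp : gamma ^+ 2 * norm2 p <= 8 * lam * N.
  apply: (tail p _ hi1) => [i|i j].
    by rewrite inE -leNgt /p => hu; apply/max_idPl; rewrite subr_le0.
  apply: (le_trans (max0_lipschitz _ _)).
  by rewrite [leRHS](_ : _ = (u i - hi - (u j - hi)) ^+ 2) //; ring.
have hq : gamma ^+ 2 * norm2 q <= 8 * lam * N.
  apply: (tail q _ lo1) => [i|i j].
    by rewrite inE -leNgt /q => hu; apply/max_idPl; rewrite subr_le0.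
  apply: (le_trans (max0_lipschitz _ _)).
  by rewrite [leRHS](_ : _ = (lo - u i - (lo - u j)) ^+ 2) //; ring.
(* For large [eps] the two quantiles may cross. The maximum makes the estimate [NW] valid in any
   case, and [NW] then excludes [W = 0]. *)
pose W := Num.max 0 (hi - lo).
have W0 : 0 <= W by rewrite le_max lexx.
(* As [u] has mean 0, shifting it by [lo] cannot decrease its norm, and
   [|u i - lo| <= W + p i + q i]. The two tails together carry at most [N / 6], whence 96 = 16 * 6;
   three times this is [N / 2], which the left side absorbs. *)
have NW : N <= 6 * n%:R * W ^+ 2.
  have h1 : N <= norm2 (fun i => u i - lo).
    rewrite /norm2 (eq_bigr (fun i => u i ^+ 2 + (- 2 * lo * u i + lo ^+ 2)));
      last by move=> *; ring.
    rewrite big_split /= -/(norm2 u) -/N lerDl big_split /= -mulr_sumr u0 mulr0 add0r.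
    by apply: sumr_ge0 => *; apply: sqr_ge0.
  have h2 : norm2 (fun i => u i - lo) <= 3 * (n%:R * W ^+ 2 + norm2 p + norm2 q).
    have -> : n%:R * W ^+ 2 = \sum_(i < n) W ^+ 2 by rewrite sumr_const card_ord mulr_natl.
    rewrite -!big_split mulr_sumr; apply: ler_sum => i _ /=.
    have : `|u i - lo| <= W + p i + q i.
      by rewrite /W /p /q ler_norml /Num.max; do 3 case: ifP; lra.
    have p0 : 0 <= p i by rewrite le_max lexx.
    have q0 : 0 <= q i by rewrite le_max lexx.
    move: W0 p0 q0; move: W (p i) (q i) => a b c a0 b0' c0 hl.
    apply: (@le_trans _ _ ((a + b + c) ^+ 2)).
      by rewrite -(real_normK (num_real (u i - lo))) lerXn2r ?nnegrE // !addr_ge0.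
    by have := sqr_ge0 (a - b); have := sqr_ge0 (b - c); have := sqr_ge0 (a - c); lra.
  have h3 : gamma ^+ 2 * (norm2 p + norm2 q) <= gamma ^+ 2 * (N / 6).
    have : 16 * lam * N <= 16 * (gamma ^+ 2 / 96) * N.
      by rewrite ler_pM2r // ler_pM2l.
    by lra.
  rewrite ler_pM2l ?exprn_gt0 // in h3; lra.
have Wpos : 0 < W.
  rewrite lt_neqAle W0 andbT; apply/negP => /eqP h; move: NW; rewrite -h expr0n mulr0.
  by rewrite leNgt Npos.
have WE : W = hi - lo by move: Wpos; rewrite /W /Num.max; case: ifP; rewrite ?ltxx.
(* [K] exceeds [eps^-1], so the sparsest of [K] bands has at most [eps * n] vertices; [eps <= 1]
   keeps it below [2 / eps]. *)
pose K := (Num.truncn eps^-1).+1.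
have /andP[_ K1] : (Num.truncn eps^-1)%:R <= eps^-1 < (Num.truncn eps^-1).+1%:R.
  by rewrite truncn_itv // invr_ge0 ltW.
rewrite -/K in K1.
have K2 : K%:R <= 2 / eps.
  have : (Num.truncn eps^-1)%:R <= eps^-1 by rewrite truncn_le // invr_ge0 ltW.
  have : 1 <= eps^-1 by rewrite invf_ge1.
  by rewrite /K -natr1; lra.
have Kpos : 0 < K%:R :> R by rewrite ltr0n.
pose w := W / K%:R.
have wpos : 0 < w by rewrite divr_gt0.
(* Open bands suffice: at a boundary value the clipped function is already 0 or 1. *)
pose A (j : 'I_K) := [set i | lo + j%:R * w < u i < lo + j.+1%:R * w].
have [j Aj] : exists j, (#|A j| * K <= #|'I_n|)%N.
  apply: pigeonhole_sparse => // i k x; rewrite !inE => /andP[i1 i2] /andP[k1 k2].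
  have : (i%:R : R) < k.+1%:R by rewrite -(ltr_pM2r wpos); lra.
  have : (k%:R : R) < i.+1%:R by rewrite -(ltr_pM2r wpos); lra.
  by rewrite !ltr_nat !ltnS => ki ik; apply/val_inj/eqP; rewrite /= eqn_leq ik ki.
rewrite card_ord in Aj.
have Asmall : #|A j|%:R <= eps * n%:R.
  have : (#|A j| * K)%:R <= n%:R :> R by rewrite ler_nat.
  rewrite natrM => h; rewrite -(ler_pM2r Kpos); apply: (le_trans h).
  rewrite mulrAC -[leLHS]mul1r ler_wpM2r //.
  by rewrite mulrC -ler_pdivrMr // mul1r ltW.
pose t := lo + j%:R * w; pose y i := clip ((u i - t) / w).
have lot : lo <= t by rewrite lerDl mulr_ge0 // ltW.
have thi : t + w <= hi.
  have : (j.+1%:R : R) * w <= K%:R * w by rewrite ler_pM2r // ler_nat.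
  have -> : K%:R * w = W by rewrite /w mulrC divfK // lt0r_neq0.
  by rewrite WE -natr1 /t; lra.
have y1 i : hi <= u i -> y i = 1.
  by move=> h; apply: clip_eq1; rewrite ler_pdivlMr // mul1r; lra.
have y0 i : u i <= lo -> y i = 0.
  by move=> h; apply: clip_eq0; rewrite pmulr_lle0 ?invr_gt0 //; lra.
have hband : 2 * (beta * (eps * n%:R)) * gamma <= 9 * energy G y.
  apply: (@energy_unit_band _ _ _ _ regG _ _ y vhi) => //.
  - by move=> i; apply: clip_itv.
  - exact: y1 (lexx _).
  - move=> S hS SA; apply: (sseA _ Asmall) => //; apply: (subset_trans SA).
    apply/subsetP=> i; rewrite !inE => /clip_itvoo.
    by rewrite ltr_pdivlMr // ltr_pdivrMr // mul0r mul1r /t -natr1; lra.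
  - move=> S S1 S0 hS; apply: hcut => [i k iS kS||].
    + rewrite ltNge; apply/negP => hik; have := hS _ _ iS kS; rewrite ltNge.
      by case/negP; apply: clip_le; rewrite ler_pM2r ?invr_gt0 // lerD2r.
    + apply: (le_trans hi2); rewrite ler_nat subset_leq_card //.
      by apply/subsetP=> i; rewrite inE => /y1/S1.
    + apply: (le_trans lo2); rewrite ler_nat subset_leq_card //.
      by apply/subsetP=> i; rewrite !inE => /y0/S0.
have hy : w ^+ 2 * energy G y <= 8 * d%:R * lam * N.
  apply: le_trans hE; rewrite /energy mulr_sumr; apply: ler_sum => i _.
  rewrite mulr_sumr; apply: ler_sum => k _; rewrite mulrCA ler_wpM2l //.
  apply: (@le_trans _ _ (w ^+ 2 * ((u i - t) / w - (u k - t) / w) ^+ 2)).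
    by rewrite ler_wpM2l ?sqr_ge0 // clip_lipschitz.
  by rewrite -exprMn [X in X ^+ 2](_ : _ = u i - u k) //; field; rewrite lt0r_neq0.
have lam0 : 0 <= lam.
  have := le_trans (energy_ge0 G u) hE; rewrite pmulr_lge0 // pmulr_rge0 //.
  by rewrite mulr_gt0.
(* Here 72 = 9 * 8, from the band inequality and the energy hypothesis. With [K <= 2 / eps] and [NW]
   the final constant is 4 * 72 * 6 / 2 = 864. *)
have hW : W ^+ 2 * (2 * (beta * (eps * n%:R)) * gamma) <= K%:R ^+ 2 * (72 * d%:R * lam * N).
  have -> : W = K%:R * w by rewrite /w mulrC divfK // lt0r_neq0.
  rewrite exprMn -[leLHS]mulrA ler_wpM2l ?sqr_ge0 //.
  apply: (le_trans (ler_wpM2l (sqr_ge0 w) hband)); lra.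
have hK : K%:R ^+ 2 * (72 * d%:R * lam * N) <=
    (2 / eps) ^+ 2 * (72 * d%:R * lam * (6 * n%:R * W ^+ 2)).
  rewrite ler_pM ?sqr_ge0 ?mulr_ge0 ?ler0n ?(ltW Npos) //.
    by rewrite lerXn2r ?nnegrE // divr_ge0 // ltW.
  by rewrite ler_wpM2l // !mulr_ge0.
have := le_trans hW hK.
have pos : 0 < W ^+ 2 * n%:R * 2 by rewrite !mulr_gt0 ?exprn_gt0.
rewrite ler_pdivlMr ?mulr_gt0 ?exprn_gt0 // => hfin.
rewrite -(ler_pM2l pos).
apply: (@le_trans _ _ (eps ^+ 2 * (W ^+ 2 * (2 * (beta * (eps * n%:R)) * gamma)))).
  by rewrite le_eqVlt; apply/orP; left; apply/eqP; ring.
apply: (le_trans (ler_wpM2l (sqr_ge0 eps) hfin)).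
by rewrite le_eqVlt; apply/orP; left; apply/eqP; field; rewrite lt0r_neq0.
Qed.

End ThresholdCuts.

(** * Power iteration *)

(** If every ratio of consecutive terms were below [r * (1 - s)], then [b T] would be at most
    [(r * (1 - s)) ^ T], and [(1 - s) ^ T <= 1 / (1 + s * T)] would contradict the lower bound
    [c * r ^ T]. *)
Lemma slow_decay (R : realFieldType) (b : nat -> R) (c r s : R) (T : nat) :
    0 < r -> 0 <= s <= 1 -> b 0%N <= 1 -> c * r ^+ T <= b T ->
    1 < c * (1 + s * T%:R) ->
  exists2 t, (t < T)%N & r * (1 - s) * b t <= b t.+1.
Proof.
move=> r0 /andP[s0 s1] b1 bT cs.
have [/existsP[t ht]|/existsPn h] := boolP [exists t : 'I_T, r * (1 - s) * b t <= b t.+1].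
  by exists t.
have rs : 0 <= r * (1 - s) by rewrite mulr_ge0 ?subr_ge0 // ltW.
have decay t : (t <= T)%N -> b t <= (r * (1 - s)) ^+ t.
  elim: t => [|t IH] ht; first by rewrite expr0.
  have := h (Ordinal ht); rewrite -ltNge => /ltW /le_trans; apply.
  by rewrite exprS ler_wpM2l // IH // ltnW.
have bern t : (1 - s) ^+ t * (1 + s * t%:R) <= 1.
  elim: t => [|t IH]; first by rewrite expr0 mulr0 addr0 mulr1.
  apply: le_trans IH; rewrite exprSr -mulrA ler_wpM2l ?exprn_ge0 ?subr_ge0 //.
  have : 0 <= s * (s * t.+1%:R) by rewrite !mulr_ge0.
  by rewrite -natr1; lra.
have sT : 0 < 1 + s * T%:R by rewrite ltr_wpDr // mulr_ge0.
have := le_trans bT (decay T (leqnn T)); rewrite exprMn mulrC.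
rewrite ler_pM2l ?exprn_gt0 // -(ler_pM2r sT) => /le_trans/(_ (bern T)).
by rewrite leNgt cs.
Qed.

Section LazyWalk.
Variables (R : realFieldType) (n d : nat) (G : sgraph n).
Hypothesis regG : regular d G.
Implicit Types (f g u : 'I_n -> R) (S : {set 'I_n}).

(* The operator [d I + A], a multiple of the lazy walk; adding [f i] along each
   edge makes it independent of [d]. *)
Definition step f (i : 'I_n) : R := \sum_j (G i j)%:R * (f i + f j).
Definition dot f g : R := \sum_i f i * g i.

(** The form of the signless Laplacian. Its symmetry makes [step] self-adjoint, and for [g = f] it
    is a sum of squares. *)
Lemma dot_stepE f g : dot f (step g) *+ 2 =
  \sum_i \sum_j (G i j)%:R * ((f i + f j) * (g i + g j)).
Proof.
have h : dot f (step g) = \sum_i \sum_j (G i j)%:R * (f i * (g i + g j)).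
  by apply: eq_bigr => i _; rewrite mulr_sumr; apply: eq_bigr => j _; rewrite mulrCA.
rewrite mulr2n {1}h h -{2}(sum_edge_swap G (fun i j => f i * (g i + g j))).
rewrite -big_split; apply: eq_bigr => i _; rewrite -big_split.
by apply: eq_bigr => j _ /=; ring.
Qed.

Lemma dot_step f g : dot f (step g) = dot (step f) g.
Proof.
apply: (@pmulrnI R 2) => //.
have -> : dot (step f) g = dot g (step f) by apply: eq_bigr => *; rewrite mulrC.
rewrite !dot_stepE; apply: eq_bigr => i _; apply: eq_bigr => j _; ring.
Qed.

Lemma sum_step f : \sum_i step f i = 2 * d%:R * \sum_i f i.
Proof.
transitivity (\sum_i (\sum_j (G i j)%:R * f i + \sum_j (G i j)%:R * f j)).
  apply: eq_bigr => i _; rewrite -big_split; apply: eq_bigr => j _; exact: mulrDr.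
rewrite big_split /= (sum_edgel regG f) (sum_edger regG f); ring.
Qed.

Lemma energy_step f : energy G f = 4 * d%:R * norm2 f - dot f (step f) *+ 2.
Proof.
rewrite dot_stepE; apply/eqP; rewrite eq_sym subr_eq; apply/eqP.
transitivity (2 * (\sum_i \sum_j (G i j)%:R * f i ^+ 2) +
              2 * (\sum_i \sum_j (G i j)%:R * f j ^+ 2)).
  rewrite (sum_edgel regG (fun i => f i ^+ 2)) (sum_edger regG (fun i => f i ^+ 2)).
  by rewrite /norm2; ring.
rewrite !mulr_sumr -!big_split; apply: eq_bigr => i _ /=.
by rewrite !mulr_sumr -!big_split; apply: eq_bigr => j _ /=; ring.
Qed.

(** Spectrally, [step] has its eigenvalues between 0 and 2d, so its square is at most 2d times
    itself. Diagonalization is avoided: at each vertex [i] the variance of [f i + f j] over the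
    neighbours [j] is nonnegative. *)
Lemma norm2_step f : (0 < d)%N -> norm2 (step f) <= d%:R * (dot f (step f) *+ 2).
Proof.
move=> d0; rewrite dot_stepE mulr_sumr; apply: ler_sum => i _.
have dpos : 0 < d%:R :> R by rewrite ltr0n.
pose m := step f i / d%:R.
have sE : step f i = d%:R * m by rewrite /m mulrC divfK // lt0r_neq0.
have degE : \sum_j (G i j)%:R = d%:R :> R.
  by rewrite -natr_sum -(regG i) cardsE -sum1_card [in RHS]big_mkcond.
have : 0 <= \sum_j (G i j)%:R * (f i + f j - m) ^+ 2.
  by apply: sumr_ge0 => j _; rewrite mulr_ge0 ?sqr_ge0.
rewrite (eq_bigr (fun j => (G i j)%:R * ((f i + f j) * (f i + f j)) +
   ((- 2 * m) * ((G i j)%:R * (f i + f j)) + m ^+ 2 * (G i j)%:R))); last first.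
  by move=> j _; ring.
rewrite big_split big_split /= -!mulr_sumr -/(step f i) sE degE.
set X := \sum_j _ => hX; rewrite exprMn.
by rewrite [d%:R ^+ 2]expr2 -mulrA ler_pM2l //; lra.
Qed.

Lemma cauchy_schwarz f g : dot f g ^+ 2 <= norm2 f * norm2 g.
Proof.
have [f0|f0] := eqVneq (norm2 f) 0; last first.
  have fpos : 0 < norm2 f by rewrite lt_neqAle eq_sym f0 norm2_ge0.
  have := norm2_ge0 (fun i => norm2 f * g i - dot f g * f i).
  have -> : norm2 (fun i => norm2 f * g i - dot f g * f i) =
      norm2 f * (norm2 f * norm2 g - dot f g ^+ 2).
    rewrite [LHS](eq_bigr (fun i => norm2 f ^+ 2 * g i ^+ 2 +
      (- 2 * norm2 f * dot f g * (f i * g i) + dot f g ^+ 2 * f i ^+ 2))); last first.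
      by move=> i _; ring.
    by rewrite !big_split /= -!mulr_sumr -/(dot f g) -/(norm2 f) -/(norm2 g); ring.
  by rewrite pmulr_rge0 // subr_ge0.
have fz i : f i = 0.
  apply/eqP; rewrite -sqrf_eq0 eq_le sqr_ge0 andbT -[leRHS]f0.
  by rewrite /norm2 (bigD1 i) //= lerDl sumr_ge0 // => *; rewrite sqr_ge0.
by rewrite f0 mul0r /dot big1 ?expr0n // => i _; rewrite fz mul0r.
Qed.

Definition centered_delta (v i : 'I_n) : R := (i == v)%:R - n%:R^-1.

Lemma sum_centered_delta v : \sum_i centered_delta v i = 0.
Proof.
rewrite big_split /= sumr_const card_ord (bigD1 v) //= eqxx big1; last by move=> i /negPf ->.
rewrite addr0 -[_ *+ n]mulr_natr mulNr mulVf ?subrr // pnatr_eq0 -lt0n.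
exact: leq_ltn_trans (leq0n v) (ltn_ord v).
Qed.

Lemma norm2_centered_delta v : norm2 (centered_delta v) <= 1.
Proof.
have n0 : (0 < n)%N := leq_ltn_trans (leq0n v) (ltn_ord v).
have nneq : n%:R != 0 :> R by rewrite pnatr_eq0 -lt0n.
rewrite /norm2 (eq_bigr (fun i => (i == v)%:R +
  (- 2 * n%:R^-1 * (i == v)%:R + n%:R^-1 ^+ 2))); last first.
  by move=> i _; rewrite /centered_delta; case: (i == v); rewrite /=; ring.
rewrite !big_split /= -mulr_sumr sumr_const card_ord.
have -> : \sum_(i < n) (i == v)%:R = 1 :> R.
  by rewrite (bigD1 v) //= eqxx big1 ?addr0 // => i /negPf ->.
rewrite -[n%:R^-1 ^+ 2 *+ n]mulr_natr expr2 -mulrA mulVf // mulr1.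
have : 0 <= n%:R^-1 :> R by rewrite invr_ge0.
lra.
Qed.

Lemma sum_iter_step t f : \sum_i f i = 0 -> \sum_i iter t step f i = 0.
Proof. by move=> h; elim: t => //= t IH; rewrite sum_step IH mulr0. Qed.

(** Choose [v] with [f v ^ 2] maximal, hence at least [norm2 f / n]. Pairing the iterates with the
    eigenvector [f] gives exactly [((1 + x) * d) ^ t * f v], so by Cauchy-Schwarz their squared
    norms are at least [r ^ t / n]. [slow_decay] finds a step with little loss, and [norm2_step]
    turns it into a bound on the energy. *)
Lemma slow_iterate f (x s : R) (T : nat) :
    (0 < d)%N -> \sum_i f i = 0 -> 0 < norm2 f ->
    (forall i, \sum_j (G i j)%:R * f j = x * d%:R * f i) ->
    0 <= x <= 1 -> 0 <= s <= 1 -> n%:R < 1 + s * T%:R ->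
  exists v, exists2 t, (t < T)%N &
    let u := iter t step (centered_delta v) in
    0 < norm2 u /\ energy G u <= 4 * d%:R * (1 - x + s) * norm2 u.
Proof.
move=> d0 f0 Nf fE /andP[x0 x1] s01 sT.
have dpos : 0 < d%:R :> R by rewrite ltr0n.
have n0 : (0 < n)%N.
  rewrite lt0n; apply/negP => /eqP n0; move: Nf; rewrite /norm2 big1 ?ltxx // => i _.
  by have := ltn_ord i; rewrite {2}n0.
have npos : 0 < n%:R :> R by rewrite ltr0n.
have stepE i : step f i = (1 + x) * d%:R * f i.
  rewrite /step (eq_bigr (fun j => (G i j)%:R * f i + (G i j)%:R * f j)); last by move=> *; ring.
  rewrite big_split /= fE -mulr_suml -natr_sum.
  have -> : (\sum_j G i j)%N = d by rewrite -(regG i) cardsE -sum1_card [in RHS]big_mkcond.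
  ring.
pose r := ((1 + x) * d%:R) ^+ 2.
have r0 : 0 < r by rewrite exprn_gt0 // mulr_gt0 // ltr_wpDr.
have [v hv] : exists v, norm2 f <= n%:R * f v ^+ 2.
  have [v _ hv] := @arg_maxP _ _ _ (Ordinal n0) predT (fun i => f i ^+ 2) isT.
  exists v.
  have -> : n%:R * f v ^+ 2 = \sum_(i < n) f v ^+ 2 by rewrite sumr_const card_ord mulr_natl.
  by apply: ler_sum => i _; apply: hv.
exists v; set e := centered_delta v.
have dotE t : dot f (iter t step e) = ((1 + x) * d%:R) ^+ t * f v.
  elim: t => [|t IH] /=.
    rewrite expr0 mul1r /dot /e /centered_delta (eq_bigr (fun i =>
      f i * (i == v)%:R + (- n%:R^-1) * f i)); last by move=> *; ring.
    rewrite big_split /= -mulr_sumr f0 mulr0 addr0 (bigD1 v) //= eqxx mulr1 big1 ?addr0 //.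
    by move=> i /negPf ->; rewrite mulr0.
  rewrite dot_step /dot (eq_bigr (fun i => (1 + x) * d%:R * (f i * iter t step e i))); last first.
    by move=> i _; rewrite stepE mulrA.
  by rewrite -mulr_sumr -/(dot f _) IH exprS mulrA.
have lowb t : n%:R^-1 * r ^+ t <= norm2 (iter t step e).
  rewrite -(ler_pM2l Nf); apply: le_trans (cauchy_schwarz _ _).
  rewrite dotE [(_ * f v) ^+ 2]exprMn /r exprAC.
  rewrite mulrA mulrC ler_wpM2l ?sqr_ge0 //.
  by rewrite ler_pdivrMr // mulrC.
have sc : 1 < n%:R^-1 * (1 + s * T%:R) by rewrite mulrC ltr_pdivlMr // mul1r.
have [t tT ht] := @slow_decay R (fun t => norm2 (iter t step e)) n%:R^-1 r s T r0 s01
  (norm2_centered_delta v) (lowb T) sc.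
exists t => //=; set u := iter t step e in ht *.
  have Nu : 0 < norm2 u.
    by apply: (lt_le_trans _ (lowb t)); apply: mulr_gt0; [rewrite invr_gt0 | apply: exprn_gt0].
  split=> //; rewrite energy_step; have := norm2_step u d0.
  move=> /(le_trans ht); move=> h.
  case/andP: s01 => s0 s1; rewrite -(ler_pM2l dpos).
  (* The slack of the estimate: [4 (1 - x + s) - (4 - (1 + x)^2 (1 - s)) = s (1 - x) (3 + x) + (1 -
     x)^2]. *)
  have h1 : 0 <= d%:R ^+ 2 * norm2 u * (s * ((1 - x) * (3 + x)) + (1 - x) ^+ 2).
    rewrite mulr_ge0 ?mulr_ge0 ?sqr_ge0 ?(ltW Nu) // addr_ge0 ?sqr_ge0 //.
    by rewrite !mulr_ge0 // ?subr_ge0 // addr_ge0.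
  move: h h1; rewrite /r; move: (norm2 u) (dot _ _ *+ 2) => p q; lra.
Qed.

Lemma deg_le : (0 < n)%N -> (d <= n)%N.
Proof. by move=> n0; rewrite -(regG (Ordinal n0)) -[leqRHS]card_ord max_card. Qed.

(** Coarea with unit weight at a maximum of [u] bounds the variation below by twice the range [r],
    while [u], having mean 0, satisfies [norm2 u <= n * r ^ 2]. *)
Lemma energy_connected u : (0 < n)%N -> \sum_i u i = 0 ->
    (forall S, S != set0 -> ~: S != set0 ->
       (forall i j, i \in S -> j \notin S -> u j < u i) -> (0 < cutsize G S)%N) ->
  4 * norm2 u <= n%:R ^+ 3 * energy G u.
Proof.
move=> n0 u0 hcut.
have npos : 0 < n%:R :> R by rewrite ltr0n.
have [a _ amin] := @arg_minP _ _ _ (Ordinal n0) predT u isT.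
have [b _ bmax] := @arg_maxP _ _ _ (Ordinal n0) predT u isT.
pose r := u b - u a; pose h i := u i - u a.
have h0 i : 0 <= h i by rewrite subr_ge0; apply: amin.
have r0 : 0 <= r := h0 b.
have hr : r *+ 2 <= variation G u.
  have -> : variation G u = variation G h.
    by apply: eq_bigr => i _; apply: eq_bigr => j _; rewrite /h opprB addrA subrK.
  have <- : \sum_i (i == b)%:R * h i = r.
    by rewrite (bigD1 b) //= eqxx mul1r big1 ?addr0 // => i /negPf ->; rewrite mul0r.
  apply: coarea => // x x0 hS.
  have /set0Pn[k] := hS; rewrite inE => hk.
  have hb : x < h b by apply: lt_le_trans hk _; rewrite lerD2r; apply: bmax.
  rewrite (bigD1 b) //= eqxx big1 ?addr0; last by move=> i /andP[_ /negPf ->].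
  rewrite ler1n; apply: hcut => // [|i j].
    by apply/set0Pn; exists a; rewrite !inE -leNgt /h subrr.
  by rewrite !inE -leNgt => hi /le_lt_trans/(_ hi); rewrite /h ltrD2r.
have [rz|rn] := eqVneq r 0.
  have uz i : u i = 0.
    have ua j : u j = u a.
      by apply: le_anti; rewrite (le_trans (bmax j isT)) ?amin //; rewrite -subr_le0 -/r rz.
    have := u0; rewrite (eq_bigr (fun=> u a)) // sumr_const card_ord -[_ *+ n]mulr_natr => /eqP.
    by rewrite mulf_eq0 (gt_eqF npos) orbF ua => /eqP.
  by rewrite /norm2 big1 => [|i _]; rewrite ?uz ?expr0n // mulr0 mulr_ge0 ?exprn_ge0 ?energy_ge0.
have rpos : 0 < r by rewrite lt_neqAle eq_sym rn.
have hN : norm2 u <= n%:R * r ^+ 2.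
  apply: (@le_trans _ _ (norm2 h)).
    rewrite [leRHS](eq_bigr (fun i => u i ^+ 2 + (- 2 * u a * u i + u a ^+ 2))); last first.
      by move=> i _; rewrite /h; ring.
    rewrite big_split /= lerDl big_split /= -mulr_sumr u0 mulr0 add0r.
    by apply: sumr_ge0 => *; apply: sqr_ge0.
  have -> : n%:R * r ^+ 2 = \sum_(i < n) r ^+ 2 by rewrite sumr_const card_ord mulr_natl.
  by apply: ler_sum => i _; rewrite lerXn2r ?nnegrE // lerD2r; apply: bmax.
(* AM-GM on each edge, [4 r z <= n^2 z^2 + 4 (r / n)^2]. Over the [d n] ordered edges the last term
   sums to at most [4 r^2], half of what [hr] provides. *)
have hV : 4 * r * variation G u <= n%:R ^+ 2 * energy G u + 4 * r ^+ 2.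
  apply: (@le_trans _ _ (\sum_i \sum_j (n%:R ^+ 2 * ((G i j)%:R * (u i - u j) ^+ 2) +
      (G i j)%:R * (4 * (r / n%:R) ^+ 2)))).
    rewrite /variation mulr_sumr; apply: ler_sum => i _; rewrite mulr_sumr.
    apply: ler_sum => j _; rewrite mulrCA [_ ^+ 2 * _]mulrCA -mulrDr ler_wpM2l //.
    rewrite -(real_normK (num_real (u i - u j))); set z := `|_|.
    have -> : r = n%:R * (r / n%:R) by rewrite mulrC divfK // lt0r_neq0.
    rewrite [n%:R * _ / n%:R]mulrAC divff ?lt0r_neq0 // mul1r.
    by have := sqr_ge0 (n%:R * z - 2 * (r / n%:R)); lra.
  under eq_bigr do rewrite big_split /= -mulr_sumr.
  rewrite big_split /= -mulr_sumr -/(energy G u) lerD2l.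
  rewrite (sum_edgel regG (fun=> 4 * (r / n%:R) ^+ 2)).
  rewrite sumr_const card_ord -[_ *+ n]mulr_natr.
  have -> : d%:R * (4 * (r / n%:R) ^+ 2 * n%:R) = 4 * r ^+ 2 * (d%:R / n%:R).
    by field; rewrite lt0r_neq0.
  rewrite -[leRHS]mulr1 ler_wpM2l ?mulr_ge0 ?sqr_ge0 // ler_pdivrMr // mul1r ler_nat.
  exact: deg_le.
have hr' : 4 * r * (r *+ 2) <= 4 * r * variation G u by rewrite ler_wpM2l ?mulr_ge0.
have hE : 4 * r ^+ 2 <= n%:R ^+ 2 * energy G u.
  have := le_trans hr' hV; move: (energy G u) => z; lra.
have : 4 * norm2 u <= n%:R * (4 * r ^+ 2) by lra.
move=> /le_trans; apply; by rewrite exprS -[leRHS]mulrA ler_wpM2l.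
Qed.

End LazyWalk.

(** * A mean-zero eigenvector for the second eigenvalue *)

Lemma count_flatten_nseq (T : eqType) (m : T -> nat) (s : seq T) (x : T) :
  uniq s -> count_mem x (flatten [seq nseq (m y) y | y <- s]) = ((x \in s) * m x)%N.
Proof.
elim: s => //= a s IH /andP[as_ us]; rewrite count_cat count_nseq IH // inE /= eq_sym.
by case: eqVneq as_ => [->|_] //= /negPf ->; rewrite addn0.
Qed.

Section SecondEigenvalue.
Variables (R : realType) (n d : nat) (G : sgraph n).
Hypotheses (regG : regular d G) (d0 : (0 < d)%N).

Let dpos : 0 < d%:R :> R. Proof. by rewrite ltr0n. Qed.

Lemma eigenspaceE (v : 'rV[R]_n) x :
    (v <= eigenspace (transition_mx R d G) x)%MS ->
  forall i, \sum_j (G i j)%:R * v 0 j = x * d%:R * v 0 i.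
Proof.
move=> /eigenspaceP/rowP h i; have := h i; rewrite !mxE => hi.
rewrite mulrAC -hi mulr_suml; apply: eq_bigr => j _.
by rewrite !mxE adj_sym; field; rewrite lt0r_neq0.
Qed.

Lemma norm2_row (v : 'rV[R]_n) : v != 0 -> 0 < norm2 (v 0).
Proof.
move=> v0; rewrite lt_neqAle norm2_ge0 andbT eq_sym; apply: contra v0.
rewrite psumr_eq0 => [|i _]; last exact: sqr_ge0.
move=> /allP h; apply/eqP/rowP => i; rewrite mxE; apply/eqP.
by rewrite -sqrf_eq0 (implyP (h i (mem_index_enum i))).
Qed.

Lemma eigenvalue_le1 (f : 'I_n -> R) x : 0 < norm2 f ->
  (forall i, \sum_j (G i j)%:R * f j = x * d%:R * f i) -> x <= 1.
Proof.
move=> Nf fE; have := energy_ge0 G f; rewrite (energy_step regG).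
have -> : dot f (step G f) = (1 + x) * d%:R * norm2 f.
  rewrite /norm2 mulr_sumr; apply: eq_bigr => i _; rewrite /step.
  rewrite (eq_bigr (fun j => (G i j)%:R * f i + (G i j)%:R * f j)); last by move=> *; ring.
  rewrite big_split /= fE -mulr_suml -natr_sum.
  have -> : (\sum_j G i j)%N = d by rewrite -(regG i) cardsE -sum1_card [in RHS]big_mkcond.
  ring.
have -> : 4 * d%:R * norm2 f - (1 + x) * d%:R * norm2 f *+ 2 =
  2 * (d%:R * norm2 f) * (1 - x) by ring.
by rewrite pmulr_rge0 ?subr_ge0 // !mulr_gt0.
Qed.

Lemma count_eigenvalues (A : 'M[R]_n) x :
  (count_mem x (eigenvalues A) <= \rank (eigenspace A x))%N.
Proof.
rewrite /eigenvalues count_sort count_flatten_nseq ?uniq_roots //.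
by case: (x \in _); rewrite ?mul1n ?mul0n.
Qed.

(** An eigenvector for a value other than 1 has mean 0, by summing the eigenvalue equation over all
    vertices. If the second value is 1, so is the first, and an eigenspace of dimension at least 2
    meets the hyperplane of mean-zero vectors. The condition [!= 0] rules out the default value of
    [nth]. *)
Lemma lambda2_eigenvector : (0 < n)%N -> lambda2 R d G != 0 ->
  lambda2 R d G <= 1 /\ exists f : 'I_n -> R, [/\ \sum_i f i = 0, 0 < norm2 f
    & forall i, \sum_j (G i j)%:R * f j = lambda2 R d G * d%:R * f i].
Proof.
move=> n0; rewrite /lambda2; set l := eigenvalues _; set x := l`_1 => x0.
have sl : (1 < size l)%N by rewrite ltnNge; apply: contra x0 => hl; rewrite /x nth_default.
have eig y : y \in l -> exists2 v : 'rV[R]_n, (v <= eigenspace (transition_mx R d G) y)%MS & v != 0.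
  move=> yl; apply/rowV0Pn; rewrite -mxrank_eq0 -lt0n.
  by apply: leq_trans (count_eigenvalues _ _); rewrite -has_count has_pred1.
have eig1 y : y \in l -> y <= 1.
  move=> /eig[v /eigenspaceE vE /norm2_row vN]; exact: eigenvalue_le1 vN vE.
have xl : x \in l by apply: mem_nth.
split; first exact: eig1.
have [x1|x1] := eqVneq x 1; last first.
  have [v /eigenspaceE vE /norm2_row vN] := eig x xl.
  exists (v 0); split=> //.
  have := sum_edger regG (v 0); rewrite (eq_bigr _ (fun i _ => vE i)) -mulr_sumr => /eqP.
  rewrite -subr_eq0 -mulrBl mulf_eq0 => /orP[|/eqP //].
  by rewrite -{2}[d%:R]mul1r -mulrBl mulf_eq0 subr_eq0 (negPf x1) (gt_eqF dpos).
have x0l : l`_0 = 1.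
  apply: le_anti; rewrite eig1 ?mem_nth ?(ltnW sl) //= -x1.
  have : sorted >=%R l by apply: sort_sorted => a b; apply: ge_total.
  by move: sl; rewrite /x; case: l {x xl x0 x1 eig eig1} => [|a [|b s]] //= _ /andP[].
have rk2 : (1 < \rank (eigenspace (transition_mx R d G) 1))%N.
  apply: leq_trans (count_eigenvalues _ _); rewrite -/l.
  move: sl x1 x0l; rewrite /x; case: l {x xl x0 eig eig1} => [|a [|b s]] //= _ -> ->.
  by rewrite eqxx.
pose c : 'M[R]_(n, 1) := const_mx 1.
have [v] : exists2 v : 'rV[R]_n, (v <= eigenspace (transition_mx R d G) 1 :&: kermx c)%MS & v != 0.
  apply/rowV0Pn; rewrite -mxrank_eq0 -lt0n.
  have := mxrank_sum_cap (eigenspace (transition_mx R d G) 1) (kermx c).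
  have := rank_leq_col (eigenspace (transition_mx R d G) 1 + kermx c)%MS.
  have := rank_leq_col c; rewrite mxrank_ker.
  move: rk2 n0; lia.
rewrite sub_capmx => /andP[/eigenspaceE vE /sub_kermxP vc] /norm2_row vN.
exists (v 0); split=> //; last by rewrite x1.
have /matrixP/(_ 0 0) := vc; rewrite !mxE => h; rewrite -[RHS]h.
by apply: eq_bigr => i _; rewrite mxE mulr1.
Qed.

End SecondEigenvalue.

(** * Candidate sets and the expansion of the best one *)

Section Candidates.
Variables (n : nat) (G : sgraph n).

Definition natstep (U : 'I_n -> nat) (i : 'I_n) : nat := (\sum_j G i j * (U i + U j))%N.

Definition walk (v : 'I_n) (t : nat) : 'I_n -> nat :=
  iter t natstep (fun i => nat_of_bool (i == v)).

(** The flag passes to the complement, so that the smaller side of every threshold cut is a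
    candidate. *)
Definition threshold_set (U : 'I_n -> nat) (c : 'I_n) (b : bool) : {set 'I_n} :=
  [set i | (U c < U i)%N (+) b].

(** Ratios are compared by cross-multiplication in the natural numbers. The number [k] is only an
    upper bound for the cut of [S], because the search starts from a set whose cut it has not
    computed. *)
Definition best_threshold_set (S : {set 'I_n}) : Prop :=
  exists k : nat, [/\ (0 < #|S|)%N, (2 * #|S| <= n)%N, (cutsize G S <= k)%N &
    forall v t c b, (t < n ^ 6)%N -> let X := threshold_set (walk v t) c b in
      (0 < #|X|)%N -> (2 * #|X| <= n)%N -> (k * #|X| <= cutsize G X * #|S|)%N].

Lemma cutsizeC S : cutsize G (~: S) = cutsize G S.
Proof.
rewrite /cutsize exchange_big; apply: eq_bigr => i _; apply: eq_bigr => j _.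
by rewrite !inE negbK adj_sym andbCA andbC andbA andbAC.
Qed.

End Candidates.

Section Analysis.
Variables (R : realType) (n d : nat) (G : sgraph n).
Hypotheses (regG : regular d G) (d0 : (0 < d)%N).

Lemma card_incident S : #|incident G S| = (d * #|S|)%N.
Proof.
rewrite -sum1_card mulnC -sum_nat_const.
rewrite (eq_bigl (fun p => (p.1 \in S) && G p.1 p.2)); last by move=> p; rewrite inE.
rewrite -(pair_big_dep (mem S) (fun i j => G i j) (fun _ _ => 1%N)) /=.
by apply: eq_bigr => i _; rewrite sum1dep_card regG.
Qed.

Lemma card_boundary S : #|[set p in incident G S | p.2 \notin S]| = cutsize G S.
Proof.
rewrite -sum1_card /cutsize pair_big /= big_mkcond; apply: eq_bigr => p _.
by rewrite !inE; case: (p.1 \in S); case: (G p.1 p.2); case: (p.2 \in S).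
Qed.

Lemma expansionE S : expansion R G S = (cutsize G S)%:R / (d%:R * #|S|%:R).
Proof. by rewrite /expansion card_incident card_boundary natrM. Qed.

Lemma cutsize_le S : (cutsize G S <= d * #|S|)%N.
Proof. by rewrite -card_boundary -card_incident subset_leq_card // setIdE subsetIl. Qed.

Lemma expansion_le1 S : expansion R G S <= 1.
Proof.
rewrite /expansion card_incident card_boundary; have := cutsize_le S.
have [->|ne0] := eqVneq (d * #|S|)%N 0%N; first by rewrite invr0 mulr0.
by move=> h; rewrite ler_pdivrMr ?ltr0n ?lt0n // mul1r ler_nat.
Qed.

(** Constant functions are eigenvectors of [step] with eigenvalue [2 d], so centering the start
    changes the iterate by a constant. *)
Lemma walkE v t i : (walk G v t i)%:R =
  iter t (step G) (centered_delta R v) i + (2 * d%:R) ^+ t * n%:R^-1.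
Proof.
elim: t i => [|t IH] i; first by rewrite expr0 mul1r /= subrK.
rewrite /= {1}/natstep natr_sum /step exprS.
rewrite (eq_bigr (fun j => (G i j)%:R * (iter t (step G) (centered_delta R v) i +
    iter t (step G) (centered_delta R v) j) +
    (G i j)%:R * (2 * ((2 * d%:R) ^+ t * n%:R^-1)))); last first.
  by move=> j _; rewrite natrM natrD -!/(walk _ _ _) !IH; ring.
rewrite big_split /= -mulr_suml -natr_sum.
have -> : (\sum_j G i j)%N = d by rewrite -(regG i) cardsE -sum1_card [in RHS]big_mkcond.
by congr (_ + _); ring.
Qed.

Lemma upset_threshold (u : 'I_n -> R) (U : 'I_n -> nat) k S :
    (forall i, (U i)%:R = u i + k) -> ~: S != set0 ->
    (forall i j, i \in S -> j \notin S -> u j < u i) ->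
  exists c, S = threshold_set U c false.
Proof.
move=> Uu /set0Pn[a]; rewrite inE => aS up.
have [c cS hmax] := @arg_maxnP _ a (fun i => i \notin S) U aS.
exists c; apply/setP=> i; rewrite inE addbF; apply/idP/idP => [iS|].
  by rewrite -(ltr_nat R) !Uu ltrD2r up.
by apply: contraTT => /hmax; rewrite -leqNgt.
Qed.

(** Every expansion is at most 1, so the claim is trivial once [D <= 864 * delta]. This disposes of
    [delta >= 1] and of a spectral gap above [gamma ^ 2 / 96]; otherwise a slow iterate exists and
    its threshold cuts are candidates. *)
Lemma best_threshold_set_expansion (eps gamma delta : R) S :
    (1 < n)%N -> 0 < eps -> 0 < gamma -> gamma <= 1 ->
    small_set_expander eps gamma G -> 1 - delta <= lambda2 R d G ->
    best_threshold_set G S ->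
  expansion R G S <= 864 * (delta / (gamma ^+ 3 * eps ^+ 3)).
Proof.
move=> n1 e0 g0 g1 sse hdelta [k [S0 Sn kS best]].
have n0 : (0 < n)%N := ltnW n1.
have npos : 0 < n%:R :> R by rewrite ltr0n.
have dpos : 0 < d%:R :> R by rewrite ltr0n.
have sse' (A : {set 'I_n}) : A != set0 -> #|A|%:R <= eps * n%:R ->
    gamma * d%:R * #|A|%:R <= (cutsize G A)%:R.
  move=> A0 hA; have := sse A A0 hA; rewrite expansionE ler_pdivlMr ?mulrA //.
  by rewrite mulr_gt0 // ltr0n lt0n cards_eq0.
(* For larger [eps] the whole vertex set would have to expand, but its boundary is empty. *)
have e1 : eps <= 1.
  rewrite leNgt; apply/negP => e1.
  have T0 : [set: 'I_n] != set0 by apply/set0Pn; exists (Ordinal n0); rewrite inE.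
  have hT : #|[set: 'I_n]|%:R <= eps * n%:R.
    by rewrite cardsT card_ord -[leLHS]mul1r ler_wpM2r // ltW.
  have := sse' _ T0 hT; rewrite cardsT card_ord.
  have -> : cutsize G [set: 'I_n] = 0%N.
    by rewrite /cutsize big1 // => i _; rewrite big1 // => j _; rewrite !inE !andbF.
  by rewrite leNgt !mulr_gt0.
set D := gamma ^+ 3 * eps ^+ 3.
have D0 : 0 < D by rewrite mulr_gt0 ?exprn_gt0.
have eps3 : eps ^+ 3 <= 1 by rewrite exprn_ile1 // ltW.
have D1 : D <= 1 by rewrite -[leRHS]mulr1 ler_pM ?exprn_ge0 ?exprn_ile1 // ltW.
have trivial_bound : D <= 864 * delta -> expansion R G S <= 864 * (delta / D).
  move=> h; apply: (le_trans (expansion_le1 S)).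
  by rewrite mulrA ler_pdivlMr // mul1r.
have [|d1] := leP 1 delta; first by move=> h; apply: trivial_bound; lra.
have x0 : 0 < lambda2 R d G by apply: lt_le_trans hdelta; rewrite subr_gt0.
have [x1 [f [f0 Nf fE]]] := lambda2_eigenvector regG d0 n0 (lt0r_neq0 x0).
set x := lambda2 R d G in hdelta x0 x1 fE.
have delta0 : 0 <= delta by lra.
have [hlam|/ltW hlam] := leP (1 - x) (gamma ^+ 2 / 96); last first.
  apply: trivial_bound; apply: (@le_trans _ _ (gamma ^+ 2)); last by lra.
  have : gamma ^+ 3 <= gamma ^+ 2 by rewrite exprSr -[leRHS]mulr1 ler_wpM2l ?sqr_ge0.
  by apply: le_trans; rewrite -[leRHS]mulr1 ler_wpM2l // exprn_ge0 // ltW.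
(* If [S] has an empty boundary its expansion is 0. Otherwise [k > 0], and optimality puts an edge
   into every threshold cut, as [energy_connected] requires. *)
have [c0|c0] := posnP (cutsize G S).
  by rewrite expansionE c0 mul0r mulr_ge0 // divr_ge0 // ltW.
have k0 : (0 < k)%N by apply: leq_trans kS.
have n2 : 2 <= n%:R :> R by rewrite ler_nat.
(* The loss is [s = n^-5] and the horizon [T = n^6], so [s T = n] and the condition [n < 1 + s T]
   just holds. *)
have s01 : 0 <= (n%:R : R) ^- 5 <= 1.
  by rewrite invr_ge0 exprn_ge0 // invf_le1 ?exprn_gt0 // exprn_ege1 // ler1n.
have sT : n%:R < 1 + n%:R ^- 5 * (n ^ 6)%:R :> R.
  rewrite natrX [n%:R ^+ 6]exprSr mulrA mulVf ?mul1r ?ltrDr ?ltr01 //.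
  by rewrite expf_neq0 // lt0r_neq0.
have xb : 0 <= x <= 1 by rewrite ltW.
have [v [t tT /= [Nu hE]]] := slow_iterate regG d0 f0 Nf fE xb s01 sT.
set u := iter t _ _ in Nu hE.
have u0 : \sum_i u i = 0 by apply: (sum_iter_step regG); apply: sum_centered_delta.
have cand (A : {set 'I_n}) : A != set0 -> ~: A != set0 ->
    (forall i j, i \in A -> j \notin A -> u j < u i) ->
    (k * minn #|A| #|~: A| <= cutsize G A * #|S|)%N.
  move=> A0 AC up; have [c hA] := upset_threshold (walkE v t) AC up.
  have hAC : ~: A = threshold_set (walk G v t) c true.
    by rewrite hA; apply/setP=> i; rewrite !inE addbF addbT.
  have cardAC := cardsC A; rewrite card_ord in cardAC.
  have [h|h] := leqP #|A| #|~: A|.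
    rewrite [X in cutsize G X]hA {1}hA; apply: best => //; rewrite -hA ?card_gt0 //.
    by rewrite mul2n -addnn -[leqRHS]cardAC leq_add2l.
  rewrite -(cutsizeC G A) [X in cutsize G X]hAC {1}hAC.
  apply: best => //; rewrite -hAC ?card_gt0 //.
  by rewrite mul2n -addnn -[leqRHS]cardAC leq_add2r ltnW.
have hcon : 4 * norm2 u <= n%:R ^+ 3 * energy G u.
  apply: (energy_connected regG) => // A A0 AC up.
  have : (0 < cutsize G A * #|S|)%N.
    by apply: leq_trans (cand A A0 AC up); rewrite muln_gt0 k0 leq_min !card_gt0 A0.
  by rewrite muln_gt0 => /andP[].
(* The loss contributes [4 d n^-5 * norm2 u]. By [hcon], [d <= n] and [2 <= n] this is at most half
   of the energy, so dropping it doubles the constant 4. *)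
have hE8 : energy G u <= 8 * d%:R * (1 - x) * norm2 u.
  have : 4 * d%:R * n%:R ^- 5 * norm2 u * 2 <= energy G u.
    have h1 : 4 * d%:R * n%:R ^- 5 * norm2 u * 2 <=
        2 * d%:R * n%:R ^- 5 * (n%:R ^+ 3 * energy G u).
      have := ler_wpM2l _ hcon; move=> /(_ (2 * d%:R * n%:R ^- 5)) => h.
      apply: le_trans (h _); last by rewrite mulr_ge0 ?(andP s01).1 // mulr_ge0.
      by rewrite le_eqVlt; apply/orP; left; apply/eqP; ring.
    apply: (le_trans h1).
    have -> : 2 * d%:R * n%:R ^- 5 * (n%:R ^+ 3 * energy G u) =
       2 * d%:R / n%:R ^+ 2 * energy G u by field; rewrite lt0r_neq0.
    rewrite -[leRHS]mul1r ler_wpM2r ?energy_ge0 // ler_pdivrMr ?exprn_gt0 // mul1r.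
    by rewrite expr2 ler_pM // ler_nat (deg_le regG).
  lra.
have b0 : 0 <= k%:R / #|S|%:R :> R by rewrite divr_ge0.
have Spos : 0 < #|S|%:R :> R by rewrite ltr0n.
have hcut (A : {set 'I_n}) (m : R) : (forall i j, i \in A -> j \notin A -> u j < u i) ->
    m <= #|A|%:R -> m <= #|~: A|%:R -> k%:R / #|S|%:R * m <= (cutsize G A)%:R.
  move=> up mA mAC.
  have [A0|A0] := eqVneq A set0.
    apply: (@le_trans _ _ 0) => //; rewrite mulr_ge0_le0 //.
    by rewrite A0 cards0 in mA.
  have [AC|AC] := eqVneq (~: A) set0.
    apply: (@le_trans _ _ 0) => //; rewrite mulr_ge0_le0 //.
    by rewrite AC cards0 in mAC.
  rewrite mulrAC ler_pdivrMr //; apply: (@le_trans _ _ (k * minn #|A| #|~: A|)%:R).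
    by rewrite natrM ler_wpM2l // /minn; case: ifP.
  by rewrite -natrM ler_nat cand.
have := threshold_cut_bound regG n0 d0 e0 e1 g0 g1 sse' u0 Nu hE8 hcut hlam.
move=> hb; rewrite expansionE.
apply: (@le_trans _ _ (k%:R / #|S|%:R / d%:R)).
  by rewrite invfM mulrA [leLHS]mulrAC !ler_wpM2r ?invr_ge0 // ler_nat.
rewrite ler_pdivrMr //; apply: (le_trans hb).
(* The cut bound has a single factor 1/gamma; [gamma <= 1] and [1 - x <= delta] weaken it to the
   stated form. *)
rewrite mulrA ler_pdivrMr ?mulr_gt0 ?exprn_gt0 // /D.
have -> : 864 * delta / (gamma ^+ 3 * eps ^+ 3) * d%:R * (gamma * eps ^+ 3) =
  864 * d%:R * delta / gamma ^+ 2 by field; rewrite !lt0r_neq0.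
rewrite ler_pdivlMr ?exprn_gt0 // -[leRHS]mulr1 ler_pM ?exprn_ge0 ?(ltW g0) //.
- by rewrite !mulr_ge0 // subr_ge0.
- by rewrite ler_wpM2l ?mulr_ge0 //; lra.
- by rewrite exprn_ile1 // ltW.
Qed.

End Analysis.

(** * The search program *)

Section Program.
Local Open Scope nat_scope.

Local Notation vV := 0 (only parsing).
Local Notation vT := 1 (only parsing).
Local Notation vI := 2 (only parsing).
Local Notation vJ := 3 (only parsing).
Local Notation vC := 4 (only parsing).
Local Notation vB := 5 (only parsing).
Local Notation aU := 6 (only parsing).
Local Notation aW := 7 (only parsing).
Local Notation aX := 8 (only parsing).
Local Notation aBest := 9 (only parsing).
Local Notation vSize := 10 (only parsing).
Local Notation vCut := 11 (only parsing).
Local Notation vBestSize := 12 (only parsing).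
Local Notation vBestCut := 13 (only parsing).

Definition sc k : hexpr := HCell k (HNum 0).
Definition at_ a k : hexpr := HCell a (sc k).
Definition hinc k : hcmd := HSet k (HNum 0) (HAdd (sc k) (HNum 1)).
Definition edge_IJ : hexpr :=
  HLow (HAdd (HNum 1) (HAdd (HMul (sc vI) HSize) (sc vJ))).

Definition set_candidate : hcmd :=
  HFor vI 1
    (HSeq (HSet aX (sc vI) (sc vB))
      (HIf (HSub (at_ aU vI) (at_ aU vC)) (HSet aX (sc vI) (HSub (HNum 1) (sc vB))))).

Definition leaving_edge : hexpr :=
  HMul (HMul edge_IJ (at_ aX vI)) (HSub (HNum 1) (at_ aX vJ)).

Definition measure_vertex : hcmd :=
  HSeq (HIf (at_ aX vI) (hinc vSize)) (HFor vJ 1 (HIf leaving_edge (hinc vCut))).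

Definition measure_candidate : hcmd :=
  HSeq (HSet vSize (HNum 0) (HNum 0))
  (HSeq (HSet vCut (HNum 0) (HNum 0)) (HFor vI 1 measure_vertex)).

(** A product of truncated differences encodes a conjunction: the candidate is nonempty, has at most
    [n / 2] vertices, and has a strictly smaller ratio than the record. *)
Definition better_candidate : hexpr :=
  HMul (HMul (sc vSize) (HSub (HAdd HSize (HNum 1)) (HMul (HNum 2) (sc vSize))))
    (HSub (HMul (sc vBestCut) (sc vSize)) (HMul (sc vCut) (sc vBestSize))).

Definition copy_candidate : hcmd := HFor vI 1 (HSet aBest (sc vI) (at_ aX vI)).

Definition keep_better : hcmd :=
  HIf better_candidate
    (HSeq (HSet vBestSize (HNum 0) (sc vSize))
    (HSeq (HSet vBestCut (HNum 0) (sc vCut)) copy_candidate)).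

Definition try_candidate : hcmd :=
  HSeq set_candidate (HSeq measure_candidate keep_better).

(** Loop lengths are powers of [n], so the flag runs over all numbers below [n]. Every nonzero flag
    selects the complement, and [1 < n] ensures that 0 and 1 both occur. *)
Definition try_thresholds : hcmd := HFor vC 1 (HFor vB 1 try_candidate).

Definition walk_edge : hcmd :=
  HIf edge_IJ (HSet aW (sc vI) (HAdd (at_ aW vI) (HAdd (at_ aU vI) (at_ aU vJ)))).

Definition walk_vertex : hcmd :=
  HSeq (HSet aW (sc vI) (HNum 0)) (HFor vJ 1 walk_edge).

Definition walk_step : hcmd :=
  HSeq (HFor vI 1 walk_vertex) (HFor vI 1 (HSet aU (sc vI) (at_ aW vI))).

Definition start_walk : hcmd :=
  HSeq (HFor vI 1 (HSet aU (sc vI) (HNum 0))) (HSet aU (sc vV) (HNum 1)).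

Definition search_walk : hcmd :=
  HSeq start_walk (HFor vT 6 (HSeq try_thresholds walk_step)).

(** The first record is the singleton of vertex 0, with the crude bound [n] on its cut. *)
Definition search : hcmd :=
  HSeq (HSet aBest (HNum 0) (HNum 1))
  (HSeq (HSet vBestSize (HNum 0) (HNum 1))
  (HSeq (HSet vBestCut (HNum 0) HSize) (HFor vV 1 search_walk))).

Definition write_answer : hcmd := HFor vI 1 (HPut (sc vI) (at_ aBest vI)).

Definition program : hcmd := HSeq search write_answer.

Lemma wfc_program : wfc program.
Proof. by []. Qed.

Definition best_threshold_cut n (G : sgraph n) : {set 'I_n} := output G program aBest.

Variables (n : nat) (G : sgraph n).
Hypothesis n1 : 1 < n.
Implicit Types s : state.

(** A loop rule with a built-in frame: besides the invariant, each pass may use that every array the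
    loop does not write still has its value from the loop's entry. *)
Lemma hfor_ind x p c s (P : nat -> state -> Prop) :
    P 0 s ->
    (forall k s', k < n ^ p -> (forall f i, ~~ writes f (HFor x p c) -> s' f i = s f i) ->
       P k s' -> P k.+1 (hrun n c (setst s' x 0 k))) ->
    (forall s', P (n ^ p) s' -> P (n ^ p) (setst s' x 0 (n ^ p))) ->
  P (n ^ p) (hrun n (HFor x p c) s).
Proof.
move=> P0 Pstep Pend /=; apply: Pend.
pose it m := iteri m (fun i s => hrun n c (setst s x 0 i)) s.
suff h m : m <= n ^ p -> P m (it m) /\
    (forall f i, ~~ writes f (HFor x p c) -> it m f i = s f i).
  by case: (h _ (leqnn (n ^ p))).
elim: m => [|m IH] hm //.
have [IHP IHf] := IH (ltnW hm); split; first exact: Pstep.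
move=> f i hf; rewrite /= hrun_unwritten; last by move: hf; rewrite /= negb_or => /andP[].
by rewrite /setst; move: (hf); rewrite /= negb_or eq_sym => /andP[/negPf -> _]; apply: IHf.
Qed.

Definition stores_graph s := forall a, s 16 a = encode_graph G a.

Lemma encode_graphE (i j : 'I_n) : (encode_graph G (1 + (i * n + j))) = G i j.
Proof.
rewrite add1n /= (bigD1 i) //= (bigD1 j) //= eqxx /= !big1 ?addn0 // => [i' ii|j' jj].
  rewrite big1 // => j' _; case: eqP => // h; case/eqP: ii; apply/val_inj => /=.
  have := ltn_ord j; have := ltn_ord j'; move: (val i) (val i') (val j) (val j') h => a a' b b' h.
  move=> hb' hb.
  have := congr1 (divn^~ n) h; rewrite !divnMDl ?(ltnW n1) // !divn_small ?addn0 //.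
by case: eqP => // h; case/eqP: jj; apply/val_inj; rewrite /= (addnI h).
Qed.

Lemma heval_edge s : stores_graph s -> s vI 0 < n -> s vJ 0 < n ->
  heval n s edge_IJ = encode_graph G (1 + (s vI 0 * n + s vJ 0)).
Proof.
move=> hs hi hj; rewrite -hs /= /conc.
have : 1 + (s vI 0 * n + s vJ 0) <= n * n by move: (s vI 0) (s vJ 0) hi hj => a b; nia.
by case: ltngtP => // ->.
Qed.

Lemma set_candidateE s i : i < n ->
  hrun n set_candidate s aX i = if s aU (s vC 0) < s aU i then 1 - s vB 0 else s vB 0.
Proof.
pose F i := if s aU (s vC 0) < s aU i then 1 - s vB 0 else s vB 0.
pose P k (s' : state) := forall i, i < k -> s' aX i = F i.
suff h : P (n ^ 1) (hrun n set_candidate s) by move=> hi; apply: h; rewrite expn1.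
apply: hfor_ind => // k s' hk frame hP i'.
rewrite ltnS leq_eqVlt => hi.
have fC : s' vC 0 = s vC 0 by apply: frame.
have fB : s' vB 0 = s vB 0 by apply: frame.
have fU j : s' aU j = s aU j by apply: frame.
rewrite /= /setst /= !fC !fB !fU subn_eq0 -ltnNge /F; case: eqVneq hi => [->|ik] /= hi.
  by case: ifP; rewrite /= ?eqxx.
by case: ifP; rewrite /= ?(negPf ik) /=; rewrite hP.
Qed.

Definition candidate s : {set 'I_n} := [set i : 'I_n | s aX i != 0].
Definition best s : {set 'I_n} := [set i : 'I_n | s aBest i != 0].

Lemma measure_candidateE s : stores_graph s ->
  hrun n measure_candidate s vSize 0 = #|candidate s| /\
  hrun n measure_candidate s vCut 0 = cutsize G (candidate s).
Proof.
move=> hs.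
pose E i j : nat := [&& encode_graph G (1 + (i * n + j)) != 0, s aX i != 0 & s aX j == 0].
pose P k s' := s' vSize 0 = \sum_(0 <= i < k) (s aX i != 0) /\
  s' vCut 0 = \sum_(0 <= i < k) \sum_(0 <= j < n) E i j.
have : P (n ^ 1) (hrun n measure_candidate s).
  apply: (@hfor_ind vI 1 measure_vertex (setst (setst s vSize 0 0) vCut 0 0) P)
    => [|k s' hk frame [h1 h2]|//]; first by split; rewrite big_geq.
  rewrite expn1 in hk.
  have f16 a : s' 16 a = s 16 a by apply: frame.
  have fX a : s' aX a = s aX a by apply: frame.
  pose s1 := hrun n (HIf (at_ aX vI) (hinc vSize)) (setst s' vI 0 k).
  have s1E : [/\ s1 vSize 0 = s' vSize 0 + (s aX k != 0), s1 vCut 0 = s' vCut 0,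
      s1 vI 0 = k, s1 16 =1 s 16 & s1 aX =1 s aX].
    rewrite /s1 /= /setst /= !fX; case: (s aX k == 0) => /=;
    by split=> //; rewrite ?addn0.
  have [e1 e2 e3 e4 e5] := s1E.
  pose Q l s'' := s'' vCut 0 = s1 vCut 0 + \sum_(0 <= j < l) E k j.
  have hQ : Q (n ^ 1) (hrun n (HFor vJ 1 (HIf leaving_edge (hinc vCut))) s1).
    apply: hfor_ind => [|l s'' hl frame' hQ|//]; first by rewrite /Q big_geq // addn0.
    rewrite expn1 in hl; pose s2 := setst s'' vJ 0 l.
    have fI : s'' vI 0 = k by rewrite frame' // e3.
    have fX' a : s'' aX a = s aX a by rewrite frame' // e5.
    have hs2 : stores_graph s2 by move=> a; rewrite /s2 /setst /= frame' // e4 hs.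
    have eE : heval n s2 edge_IJ = encode_graph G (1 + (k * n + l)).
      by rewrite heval_edge // /s2 /setst /= fI.
    have eT : (heval n s2 leaving_edge != 0)
        = E k l :> nat.
      rewrite [heval _ _ _](_ : _ = heval n s2 edge_IJ * heval n s2 (at_ aX vI) *
        heval n s2 (HSub (HNum 1) (at_ aX vJ))) // eE /s2 /= /setst /= fI !fX'.
      by rewrite /E !muln_eq0 !negb_or -andbA subn_eq0 -leqNgt leqn0.
    have sE : \sum_(0 <= j < l.+1) E k j = \sum_(0 <= j < l) E k j + E k l by rewrite big_nat_recr.
    rewrite /Q sE addnA -hQ -eT.
    rewrite [hrun _ _ _](_ : _ =
      if heval n s2 leaving_edge != 0 then hrun n (hinc vCut) s2 else s2) //.
    by case: ifP => _; rewrite /= /setst /= ?addn0.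
  rewrite /P (_ : hrun n measure_vertex _ =
    hrun n (HFor vJ 1 (HIf leaving_edge (hinc vCut))) s1) //.
  rewrite hrun_unwritten // e1 h1; split; first by rewrite big_nat_recr.
  by rewrite hQ e2 h2 expn1 [RHS]big_nat_recr.
rewrite expn1 => -[-> ->]; split.
  rewrite big_mkord -sum1_card [RHS]big_mkcond; apply: eq_bigr => i _.
  by rewrite inE; case: (_ == _).
rewrite big_mkord; apply: eq_bigr => i _; rewrite big_mkord; apply: eq_bigr => j _.
by rewrite /E encode_graphE !inE negbK; case: (G i j).
Qed.

Definition invariant s : Prop := [/\ stores_graph s, 0 < #|best s|, 2 * #|best s| <= n,
  s vBestSize 0 = #|best s| & cutsize G (best s) <= s vBestCut 0].

Definition beats s (X : {set 'I_n}) : Prop :=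
  0 < #|X| -> 2 * #|X| <= n -> s vBestCut 0 * #|X| <= cutsize G X * s vBestSize 0.

(** Progress is the preservation of all comparisons already won, which makes it transitive without
    arithmetic on ratios. *)
Definition improves s s' : Prop :=
  invariant s' /\ forall X, beats s X -> beats s' X.

Lemma improves_trans s1 s2 s3 : improves s1 s2 -> improves s2 s3 -> improves s1 s3.
Proof. by move=> [_ h1] [i3 h2]; split=> // X /h1/h2. Qed.

Definition same_best s s' : Prop := [/\ s' 16 =1 s 16, s' aBest =1 s aBest,
  s' vBestSize 0 = s vBestSize 0 & s' vBestCut 0 = s vBestCut 0].

Lemma same_best_improves s s' : same_best s s' -> invariant s -> improves s s'.
Proof.
move=> [h1 h2 h3 h4] [i1 i2 i3 i4 i5].
have bE : best s' = best s by apply/setP=> i; rewrite !inE h2.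
split; last by move=> X; rewrite /beats h3 h4.
by split; rewrite ?bE ?h3 ?h4 // => a; rewrite h1.
Qed.

Lemma same_best_run c s :
    [&& ~~ writes 16 c, ~~ writes aBest c, ~~ writes vBestSize c & ~~ writes vBestCut c] ->
  same_best s (hrun n c s).
Proof. by move=> /and4P[? ? ? ?]; split=> [a|a||]; rewrite hrun_unwritten. Qed.

Lemma keep_betterE s : invariant s ->
    s vSize 0 = #|candidate s| -> s vCut 0 = cutsize G (candidate s) ->
  improves s (hrun n keep_better s) /\ beats (hrun n keep_better s) (candidate s).
Proof.
move=> [i1 i2 i3 i4 i5] hz hc.
pose s0 := setst (setst s vBestSize 0 (s vSize 0)) vBestCut 0 (s vCut 0).
pose s1 := hrun n copy_candidate s0.
rewrite (_ : hrun n keep_better s = if heval n s better_candidate != 0 then s1 else s) //.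
set test := heval _ _ _.
have testE : test = s vSize 0 * (n + 1 - 2 * s vSize 0) *
  (s vBestCut 0 * s vSize 0 - s vCut 0 * s vBestSize 0) by [].
case: ifP => [ht|/negbFE/eqP ht].
  have sE : forall i, i < n -> s1 aBest i = s aX i.
    pose P k s' := forall i, i < k -> s' aBest i = s aX i.
    suff h : P (n ^ 1) s1 by move=> i hi; apply: h; rewrite expn1.
    apply: hfor_ind => // k s' hk frame hP i; rewrite ltnS leq_eqVlt => hi.
    have fX a : s' aX a = s aX a by rewrite frame.
    rewrite /= /setst /= fX; case: eqVneq hi => [-> //|ik] /= hi; exact: hP.
  have bE : best s1 = candidate s by apply/setP=> i; rewrite !inE sE.
  have e12 : s1 vBestSize 0 = s vSize 0 by rewrite /s1 hrun_unwritten.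
  have e13 : s1 vBestCut 0 = s vCut 0 by rewrite /s1 hrun_unwritten.
  have e16 a : s1 16 a = s 16 a by rewrite /s1 hrun_unwritten.
  move: ht; rewrite testE !muln_eq0 !negb_or !subn_eq0 -!ltnNge hz hc i4 => /andP[/andP[z0 zn] lt].
  rewrite addn1 ltnS in zn; split; last first.
    by move=> _ _; rewrite e12 e13 hz hc.
  split; first by split; rewrite ?bE ?e12 ?e13 ?hz ?hc ?lt0n // => a; rewrite e16.
  move=> X hX X0 Xn; have := hX X0 Xn; rewrite e12 e13 hz hc i4 => h.
  (* Transitivity of the comparison of fractions: after multiplying by the positive size of the old
     record, the two cross-multiplied inequalities chain. *)
  rewrite -(leq_pmul2l i2); move: lt h i2.
  move: #|best s| #|candidate s| #|X| (cutsize G X) (cutsize G (candidate s)) (s vBestCut 0).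
  move=> a b x y z w lt h a0; apply: (@leq_trans (w * x * b)); last by nia.
  by have := leq_mul (ltnW lt) (leqnn x); nia.
split; first by split.
move=> X0 Xn; move/eqP: ht; rewrite testE !muln_eq0 !subn_eq0 hz hc.
by rewrite eqn0Ngt X0 /= addn1 ltnNge Xn.
Qed.

Lemma try_candidateE s (c : 'I_n) : invariant s -> s vC 0 = c ->
  let s' := hrun n try_candidate s in
  improves s s' /\ beats s' (threshold_set (fun i => s aU i) c (s vB 0 != 0)).
Proof.
move=> inv sC; pose s1 := hrun n set_candidate s; pose s2 := hrun n measure_candidate s1.
have i1 : improves s s1 by apply: same_best_improves inv; apply: same_best_run.
have i2 : improves s1 s2 by apply: same_best_improves i1.1; apply: same_best_run.
have cE : candidate s2 = candidate s1.
  by apply/setP=> i; rewrite !inE /s2 hrun_unwritten.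
have [|hz hc] := @measure_candidateE s1; first by case: i1 => -[].
rewrite -/s2 -cE in hz hc.
have [i3 hb] := keep_betterE i2.1 hz hc.
rewrite (_ : hrun n try_candidate s = hrun n keep_better s2) // /=; split.
  exact: improves_trans i1 (improves_trans i2 i3).
move: hb; rewrite cE; congr beats; apply/setP=> i; rewrite !inE /s1 set_candidateE // sC.
by case: ifP => _ /=; case: (s vB 0) => [|[|b]].
Qed.

Lemma try_thresholdsE s : invariant s ->
  let s' := hrun n try_thresholds s in
  improves s s' /\ forall (c : 'I_n) b, beats s' (threshold_set (fun i => s aU i) c b).
Proof.
move=> inv s'; pose U (i : 'I_n) := s aU i.
pose P k s' := improves s s' /\ forall (c : 'I_n) b, c < k -> beats s' (threshold_set U c b).
suff : P (n ^ 1) s' by rewrite expn1 => -[h1 h2]; split=> // c b; apply: h2.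
apply: (@hfor_ind vC 1 (HFor vB 1 try_candidate)) => [|k s1 hk frame [h1 h2]|s1 [h1 h2]].
- by split=> //; apply: same_best_improves.
- rewrite expn1 in hk; pose c := Ordinal hk; pose s2 := setst s1 vC 0 k.
  have i12 : improves s1 s2 by apply: same_best_improves h1.1.
  pose Q l s3 := improves s2 s3 /\ forall b : bool, b < l -> beats s3 (threshold_set U c b).
  have [h3 h4] : Q (n ^ 1) (hrun n (HFor vB 1 try_candidate) s2).
    apply: hfor_ind => [|l s3 hl frame' [h3 h4]|s3 [h3 h4]].
    + by split=> //; apply: same_best_improves i12.1.
    + pose s4 := setst s3 vB 0 l.
      have i34 : improves s3 s4 by apply: same_best_improves h3.1.
      have s4C : s4 vC 0 = c by rewrite /s4 /setst /= frame'.
      have [h5 h6] := try_candidateE i34.1 s4C.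
      have UE : (fun i : 'I_n => s4 aU i) = U.
        by apply/funext => i; rewrite /s4 /setst /= frame' // /s2 /setst /= frame.
      rewrite UE in h6; split; first exact: improves_trans h3 (improves_trans i34 h5).
      move=> b; rewrite ltnS leq_eqVlt => /orP[/eqP bl|bl].
        by move: h6; rewrite /s4 /setst /= -bl; case: (b).
      by apply: (improves_trans i34 h5).2; apply: h4.
    + have i3 : improves s3 (setst s3 vB 0 (n ^ 1)) by apply: same_best_improves h3.1.
      by split; [exact: improves_trans h3 i3 | move=> b bl; apply: i3.2; apply: h4].
  rewrite expn1 in h4; split; first exact: improves_trans h1 (improves_trans i12 h3).
  move=> c' b; rewrite ltnS leq_eqVlt => /orP[/eqP ck|ck].
    have -> : c' = c by apply: val_inj.
    by apply: h4; apply: leq_ltn_trans n1; apply: leq_b1.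
  by apply: (improves_trans i12 h3).2; apply: h2.
- have i1 : improves s1 (setst s1 vC 0 (n ^ 1)) by apply: same_best_improves h1.1.
  by split; [exact: improves_trans h1 i1 | move=> c b ck; apply: i1.2; apply: h2].
Qed.

Lemma walk_stepE s (i : 'I_n) : stores_graph s ->
  hrun n walk_step s aU i = natstep G (fun j => s aU j) i.
Proof.
move=> hs; pose E k l := (encode_graph G (1 + (k * n + l)) != 0) * (s aU k + s aU l).
pose s1 := hrun n (HFor vI 1 walk_vertex) s.
have h1 : forall k, k < n -> s1 aW k = \sum_(0 <= l < n) E k l.
  pose P m s' := forall k, k < m -> s' aW k = \sum_(0 <= l < n) E k l.
  suff h : P (n ^ 1) s1 by move=> k hk; apply: h; rewrite expn1.
  apply: hfor_ind => // m s' hm frame hP; rewrite expn1 in hm.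
  pose s2 := setst (setst s' vI 0 m) aW m 0.
  pose Q r s3 := s3 aW m = \sum_(0 <= l < r) E m l /\ forall k, k != m -> s3 aW k = s' aW k.
  have [h3 h4] : Q (n ^ 1) (hrun n (HFor vJ 1 walk_edge) s2).
    apply: hfor_ind => [|r s3 hr frame' [h3 h4]|//].
      by split=> [|k /negPf km]; rewrite /s2 /setst /= ?eqxx ?big_geq ?km.
    rewrite expn1 in hr; pose s4 := setst s3 vJ 0 r.
    have s4I : s4 vI 0 = m by rewrite /s4 /setst /= frame'.
    have s4U k : s4 aU k = s aU k by rewrite /s4 /setst /= frame' // /s2 /setst /= frame.
    have hs4 : stores_graph s4.
      by move=> a; rewrite /s4 /setst /= frame' // /s2 /setst /= frame // hs.
    have eE : heval n s4 edge_IJ = encode_graph G (1 + (m * n + r)).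
      by rewrite heval_edge // s4I.
    rewrite (_ : hrun n walk_edge (setst s3 vJ 0 r) = if heval n s4 edge_IJ != 0 then
      setst s4 aW (s4 vI 0) (s4 aW (s4 vI 0) + (s4 aU (s4 vI 0) + s4 aU (s4 vJ 0))) else s4) //.
    rewrite eE s4I !s4U; split=> [|k km].
      rewrite big_nat_recr //= -h3 /E; case: (_ != 0); last by rewrite mul0n addn0.
      by rewrite mul1n /setst !eqxx.
    by case: ifP => _; rewrite /setst /= ?(negPf km) /= -h4.
  move=> k; rewrite ltnS leq_eqVlt (_ : hrun n walk_vertex _ = hrun n (HFor vJ 1 walk_edge) s2) //.
  case: eqVneq => [-> _|km km']; first by rewrite h3 expn1.
  by rewrite h4 // (hP k km').
have h2 : forall k, k < n -> hrun n walk_step s aU k = s1 aW k.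
  pose P m s' := forall k, k < m -> s' aU k = s1 aW k.
  suff h : P (n ^ 1) (hrun n walk_step s) by move=> k hk; apply: h; rewrite expn1.
  apply: (@hfor_ind vI 1 (HSet aU (sc vI) (at_ aW vI)) s1) => // m s' hm frame hP j.
  have fW a : s' aW a = s1 aW a by rewrite frame.
  rewrite ltnS leq_eqVlt /= /setst /= fW; case: eqVneq => [-> //|jm] /=; exact: hP.
rewrite h2 // h1 // big_mkord; apply: eq_bigr => j _.
by rewrite /E encode_graphE; case: (G i j).
Qed.

Lemma start_walkE s (v i : 'I_n) : s vV 0 = v ->
  hrun n start_walk s aU i = (i == v).
Proof.
move=> sv; pose s1 := hrun n (HFor vI 1 (HSet aU (sc vI) (HNum 0))) s.
have h1 : forall k, k < n -> s1 aU k = 0.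
  pose P m s' := forall k, k < m -> s' aU k = 0.
  suff h : P (n ^ 1) s1 by move=> k hk; apply: h; rewrite expn1.
  apply: hfor_ind => // m s' hm frame hP j.
  rewrite ltnS leq_eqVlt /= /setst /=; case: eqVneq => [-> //|jm] /=; exact: hP.
have s1v : s1 vV 0 = v by rewrite /s1 hrun_unwritten.
rewrite (_ : hrun n start_walk s = setst s1 aU (s1 vV 0) 1) // s1v /setst eqxx /=.
by rewrite -val_eqE /=; case: eqP => //; rewrite h1.
Qed.

Lemma search_walkE s (v : 'I_n) : invariant s -> s vV 0 = v ->
  let s' := hrun n search_walk s in
  improves s s' /\ forall t c b, t < n ^ 6 -> beats s' (threshold_set (walk G v t) c b).
Proof.
move=> inv sv s'; pose s1 := hrun n start_walk s.
have i1 : improves s s1 by apply: same_best_improves inv; apply: same_best_run.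
pose P k s2 := [/\ improves s1 s2, forall i : 'I_n, s2 aU i = walk G v k i &
  forall t c b, t < k -> beats s2 (threshold_set (walk G v t) c b)].
suff [h1 _ h3] : P (n ^ 6) s' by split=> //; apply: improves_trans i1 h1.
apply: (@hfor_ind vT 6 (HSeq try_thresholds walk_step) s1)
  => [|k s2 hk frame [h1 h2 h3]|s2 [h1 h2 h3]].
- by split=> // [|i]; [apply: same_best_improves i1.1 | exact: start_walkE].
- pose s3 := setst s2 vT 0 k; pose s4 := hrun n try_thresholds s3; pose s5 := hrun n walk_step s4.
  have i23 : improves s2 s3 by apply: same_best_improves h1.1.
  have UE : (fun i : 'I_n => s3 aU i) = walk G v k by apply/funext => i; rewrite -h2.
  have [i34 h4] := try_thresholdsE i23.1; rewrite UE -/s4 in h4.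
  have i45 : improves s4 s5 by apply: same_best_improves i34.1; apply: same_best_run.
  have i25 := improves_trans i23 (improves_trans i34 i45).
  rewrite (_ : hrun n _ _ = s5) //; split; first exact: improves_trans h1 i25.
    move=> i; rewrite /s5 walk_stepE; last by case: i34 => -[].
    rewrite /walk iterS -/(walk G v k) -UE; congr natstep; apply/funext => j.
    by rewrite /s4 hrun_unwritten.
  move=> t c b; rewrite ltnS leq_eqVlt => /orP[/eqP ->|tk]; first by apply: i45.2; apply: h4.
  by apply: i25.2; apply: h3.
- have i2 : improves s2 (setst s2 vT 0 (n ^ 6)) by apply: same_best_improves h1.1.
  by split; [exact: improves_trans h1 i2 | exact: h2 | move=> t c b tk; apply: i2.2; apply: h3].
Qed.

Lemma searchE : let s := hrun n search (init G) in
  invariant s /\ forall v t c b, t < n ^ 6 -> beats s (threshold_set (walk G v t) c b).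
Proof.
move=> s'; pose s := setst (setst (setst (init G) aBest 0 1) vBestSize 0 1) vBestCut 0 n.
pose v0 : 'I_n := Ordinal (ltnW n1).
have bE : best s = [set v0].
  by apply/setP=> i; rewrite !inE /s /setst /init /= -val_eqE /=; case: (nat_of_ord i).
have inv : invariant s.
  split; rewrite ?bE ?cards1 //.
  rewrite /cutsize (bigD1 v0) //= [X in _ + X]big1 => [|i iv]; last first.
    by rewrite big1 // => j _; rewrite in_set1 (negPf iv) andbF.
  rewrite addn0; apply: (@leq_trans n); last exact: leqnn.
  by rewrite -[leqRHS]card_ord -sum1_card leq_sum // => j _; apply: leq_b1.
pose P k s1 := improves s s1 /\
  forall (v : 'I_n) t c b, v < k -> t < n ^ 6 -> beats s1 (threshold_set (walk G v t) c b).
suff [h1 h2] : P (n ^ 1) s'.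
  by split; [case: h1 | move=> v t c b; apply: h2; rewrite expn1].
apply: (@hfor_ind vV 1 search_walk s) => [|k s1 hk frame [h1 h2]|s1 [h1 h2]].
- by split=> //; apply: same_best_improves.
- rewrite expn1 in hk; pose s2 := setst s1 vV 0 k.
  have i12 : improves s1 s2 by apply: same_best_improves h1.1.
  have [i23 h3] := @search_walkE s2 (Ordinal hk) i12.1 erefl.
  split; first exact: improves_trans h1 (improves_trans i12 i23).
  move=> v t c b; rewrite ltnS leq_eqVlt => /orP[/eqP vk|vk] ht.
    by have -> : v = Ordinal hk by [apply: val_inj]; apply: h3.
  by apply: (improves_trans i12 i23).2; apply: h2.
- have i1 : improves s1 (setst s1 vV 0 (n ^ 1)) by apply: same_best_improves h1.1.
  by split; [exact: improves_trans h1 i1 | move=> v t c b vk ht; apply: i1.2; apply: h2].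
Qed.

(** The answer overwrites adjacency entries that are no longer read. [HPut] skips index 0, which the
    final write supplies, and cells from [n] on are not decoded. *)
Lemma output_best : best_threshold_cut G = best (hrun n search (init G)).
Proof.
set s := hrun n search (init G); pose s' := hrun n write_answer s.
have h1 : forall i, 0 < i < n -> s' 16 i = s aBest i.
  pose P k s1 := forall i, 0 < i < k -> s1 16 i = s aBest i.
  suff h : P (n ^ 1) s' by move=> i hi; apply: h; rewrite expn1.
  apply: hfor_ind => [i0|k s1 hk frame hP i0|//]; first by rewrite ltn0 andbF.
  rewrite expn1 in hk; have kn : k <= n * n.
    by apply: leq_trans (ltnW hk) _; rewrite leq_pmulr // ltnW.
  pose s2 := setst s1 vI 0 k.
  rewrite (_ : hrun n _ _ = if 0 < k <= n * n then setst s2 16 k (s1 aBest k) else s2) //.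
  rewrite kn andbT ltnS [i0 <= k]leq_eqVlt => /andP[i00]; case: (eqVneq i0 k) => [<- _|ik /= hi].
    by rewrite i00 /setst !eqxx /= frame.
  by case: ifP => _; rewrite /s2 /setst /= ?(negPf ik) /= hP // i00.
rewrite /best_threshold_cut; apply/setP=> i; rewrite !inE -/s -/s' /update.
rewrite (_ : hrun n program (init G) = s') // {1}/s' hrun_unwritten //.
case: (eqVneq (i : nat) 0) => [-> //|i0]; rewrite /conc (negPf i0).
have -> : i <= n * n by apply: leq_trans (ltnW (ltn_ord i)) _; rewrite leq_pmulr // ltnW.
by rewrite h1 // lt0n i0 ltn_ord.
Qed.

Lemma best_threshold_cutP : best_threshold_set G (best_threshold_cut G).
Proof.
rewrite output_best; have [[h1 h2 h3 h4 h5] h6] := searchE.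
exists (hrun n search (init G) vBestCut 0); split=> // v t c b ht X X0 Xn.
by rewrite -h4; apply: h6.
Qed.

End Program.

Theorem theorem1p4 (R : realType) :
  exists C : R, 0 < C /\
  exists find : forall n : nat, sgraph n -> {set 'I_n},
    polynomial_time find /\
    forall (n d : nat) (G : sgraph n) (eps gamma delta : R),
      (1 < n)%N -> (0 < d)%N -> regular d G ->
      0 < eps -> 0 < gamma -> gamma <= 1 ->
      small_set_expander eps gamma G ->
      1 - delta <= lambda2 R d G ->
      let S := find n G in
      [/\ S != set0,
          #|S|%:R <= n%:R / 2 :> R
        & expansion R G S <= C * (delta / (gamma ^+ 3 * eps ^+ 3))].
Proof.
exists 864; split; first by rewrite ltr0n.
exists best_threshold_cut; split; first exact: polynomial_time_output wfc_program _.
move=> n d G eps gamma delta n1 d0 regG e0 g0 g1 sse hdelta S.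
have best := best_threshold_cutP G n1; split.
- by rewrite -card_gt0; case: best => k [].
- rewrite ler_pdivlMr ?ltr0n // mulrC -natrM ler_nat.
  by case: best => k [].
- exact: best_threshold_set_expansion best.
Qed.
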